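(* Let $p$ and $r$ be distinct primes with $p\equiv1\pmod4$ and $\gcd(4,r)=1$. Let $t\ge1$, $m=4t$, $q=p^m$, $c=\frac{q-1}{4}$ and $k=\frac4r\Psi_r(q)$, and assume $q\equiv1\pmod r$. Let $a,b$ be integers with $\sqrt q=a^2+4b^2$, $a\equiv1\pmod4$ and $\gcd(a,p)=1$. For non-negative integers $\ell_1,\dots,\ell_4$ with $h=\ell_1+\ell_2+\ell_3+\ell_4\le r$ put $$w_{\ell_1,\ell_2,\ell_3,\ell_4}=\tfrac{p-1}{4p}\Big(hq+(\ell_1+\ell_2-\ell_3-\ell_4)\sqrt q+\big(2a(\ell_1-\ell_2)+4b(\ell_3-\ell_4)\big)p^t\Big),\qquad A_{\ell_1,\ell_2,\ell_3,\ell_4}=\binom rh\binom{h}{\ell_1,\ell_2,\ell_3,\ell_4}c^h.$$ Then the weights of $\mathcal{C}(k,q^r)$ are the numbers $w_{\ell_1,\ell_2,\ell_3,\ell_4}$, with frequencies $A_{\ell_1,\ell_2,\ell_3,\ell_4}$ (frequencies of tuples giving the same weight being added).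
   Context: $\Psi_r(x)=x^{r-1}+\cdots+x+1$. Let $Q=p^M$, $\omega$ a primitive element of $\mathbb{F}_Q$, $k\mid Q-1$, $n=\frac{Q-1}{k}$. The irreducible cyclic code $\mathcal{C}(k,Q)\subseteq\mathbb{F}_p^n$ consists of the words $c_\gamma=(\mathrm{Tr}_{Q/p}(\gamma\,\omega^{ki}))_{i=0}^{n-1}$, $\gamma\in\mathbb{F}_Q$; the weight of a word is its number of nonzero coordinates, and the frequency of $w$ is $\#\{\gamma\in\mathbb{F}_Q: w(c_\gamma)=w\}$. *)

(* Defs.v *)
From HB Require Import structures.
From mathcomp Require Import all_boot all_order all_algebra all_fingroup all_field.
Set Implicit Arguments. Unset Strict Implicit. Unset Printing Implicit Defensive.
Import Order.TTheory GRing.Theory Num.Theory.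
Local Open Scope ring_scope.

Definition Psi (r x : nat) : nat := (\sum_(i < r) x ^ i)%N.

(* Absolute trace Tr_{Q/p} on a field F of order Q = p^M :
   Tr(x) = sum_{i < M} x^(p^i). *)
Definition trace_abs (F : finFieldType) (p M : nat) (x : F) : F :=
  \sum_(i < M) x ^+ (p ^ i).

Definition cw_weight (F : finFieldType) (p M k n : nat) (omega gamma : F) : nat :=
  #|[set i : 'I_n | trace_abs p M (gamma * omega ^+ (k * i)) != 0]|.

Definition multinom4 (l1 l2 l3 l4 : nat) : nat :=
  ((l1 + l2 + l3 + l4)`! %/ (l1`! * l2`! * l3`! * l4`!))%N.

(* w_{l1,l2,l3,l4}, with sqrt q = p^(2t) and p^t = q^(1/4), as a rational *)
Definition wgt (p t : nat) (a b : int) (l1 l2 l3 l4 : nat) : rat :=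
  let q := (p ^ (4 * t))%N in
  let h := (l1 + l2 + l3 + l4)%N in
  ((p%:Q - 1) / (4 * p%:Q)) *
  ((h * q)%N%:Q
   + ((l1%:Z + l2%:Z - l3%:Z - l4%:Z)%:~R) * (p ^ (2 * t))%N%:Q
   + ((2 * a * (l1%:Z - l2%:Z) + 4 * b * (l3%:Z - l4%:Z))%:~R) * (p ^ t)%N%:Q).

Definition freqA (r c l1 l2 l3 l4 : nat) : nat :=
  let h := (l1 + l2 + l3 + l4)%N in
  ('C(r, h) * multinom4 l1 l2 l3 l4 * c ^ h)%N.

(* Main.v *)
Require Import Defs.
From HB Require Import structures.
From mathcomp Require Import all_boot all_order all_algebra all_fingroup all_field.
From mathcomp Require Import zify ring.
Set Implicit Arguments. Unset Strict Implicit. Unset Printing Implicit Defensive.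
Import Order.TTheory GRing.Theory Num.Theory.
Local Open Scope ring_scope.

(** Write q = p^(4t) = 4c + 1 and beta = omega^k, an element of order rc whose
    r-th power generates the fourth powers of F_q^*. As beta^(q-1) has order r,
    gamma |-> (Tr_{q^r/q}(gamma beta^j))_{j < r} is a bijection onto F_q^r, and
    the weight of c_gamma is the sum over j of the weights of these coordinates
    in C(4, q). The weight enumerator of the code is therefore the r-th power of
    1 + c (X^(W_0) + X^(W_1) + X^(W_2) + X^(W_3)), where W_0, ..., W_3 are the
    nonzero weights of C(4, q), and the multinomial formula gives the frequencies.

    The W_i are affine in the quartic Gauss periods eta_i, which are integers
    since F_p^* consists of fourth powers. Let G be the quartic Gauss sum and R
    the quadratic one. Then G = (eta_0 - eta_2) + i (eta_1 - eta_3),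
    |G|^2 = q = R^2 and G^2 = J R for the Jacobi sum J in Z[i]. Reducing J modulo
    a prime above p gives, up to sign, the binomial coefficient (3c choose c),
    which is prime to p. Hence G = p^t (A + i B) with A^2 + B^2 = p^(2t) and p not
    dividing A, and such a representation is unique up to signs and order. The
    sign of R only decides which of A and B is odd, so it need not be known. *)

(** * Arithmetic *)

(** In base [p] all digits of [c] equal (p - 1)/4, so multiplying by [j] < 4 produces no carry and
    commutes with dropping the last [k] digits. *)
Lemma divn_repunit4 (p m c j k : nat) :
  (1 < p)%N -> p = 1 %[mod 4] -> (p ^ m = 4 * c + 1)%N -> (j < 4)%N ->
  (j * c %/ p ^ k = j * (c %/ p ^ k))%N.
Proof.
move=> p_gt1 p1 hq lt_j4.
have p0 : (0 < p)%N by lia.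
have pX1 i : (p ^ i = 4 * (p ^ i %/ 4) + 1)%N.
  have : (p ^ i = 1 %[mod 4])%N by rewrite -modnXm p1 modnXm exp1n.
  by rewrite {2}(divn_eq (p ^ i) 4) => ->; rewrite mulnC.
have pX_gt0 i : (0 < p ^ i)%N by rewrite expn_gt0 p0.
have [le_km | lt_mk] := leqP k m.
  have := pX1 k; have := pX1 (m - k)%N; have := pX_gt0 k.
  have : (p ^ m = p ^ (m - k) * p ^ k)%N by rewrite -expnD subnK.
  rewrite hq; move: (p ^ k)%N (p ^ (m - k))%N => P R.
  move: (P %/ 4)%N (R %/ 4)%N => x y hRP P_gt0 hR hP.
  have -> : c = (y * P + x)%N by nia.
  have -> : (j * (y * P + x) = j * y * P + j * x)%N by ring.
  by rewrite !divnMDl // !divn_small ?addn0 //; nia.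
have hlt : (p ^ m < p ^ k)%N by rewrite ltn_exp2l.
by rewrite !divn_small ?muln0 //; nia.
Qed.

(** By Legendre's formula and the absence of carries, the [p]-adic valuations of c!, (2c)! and (3c)!
    are in the ratio 1 : 2 : 3, so they cancel in the binomial coefficient. *)
Lemma bin_repunit4_Ndvd (p m c : nat) :
  prime p -> p = 1 %[mod 4] -> (p ^ m = 4 * c + 1)%N ->
  ~~ (p %| 'C(3 * c, c))%N.
Proof.
move=> hp p1 hq.
have p_gt1 := prime_gt1 hp.
have le_c3 : (c <= 3 * c)%N by lia.
have logf j : (j < 4)%N ->
    logn p (j * c)`! = (j * \sum_(1 <= k < (3 * c).+1) c %/ p ^ k)%N.
  move=> lt_j4; rewrite logn_fact // big_distrr /=.
  (* Legendre's sum for (jc)! is extended to the common range up to 3c; the added terms vanish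
     because [p ^ k] exceeds jc there. *)
  have le_j : ((j * c).+1 <= (3 * c).+1)%N by rewrite ltnS leq_mul2r; lia.
  rewrite [RHS](big_cat_nat _ le_j) //= [X in _ = (_ + X)%N]big_nat_cond.
  rewrite [X in _ = (_ + X)%N]big1 ?addn0.
    by apply: eq_bigr => k _; rewrite (divn_repunit4 _ p_gt1 p1 hq).
  move=> k /andP[/andP[lt_k _] _].
  rewrite -(divn_repunit4 _ p_gt1 p1 hq) // divn_small //.
  by apply: leq_trans lt_k (ltnW (ltn_expl _ p_gt1)).
have := congr1 (logn p) (bin_fact le_c3).
have -> : (3 * c - c = 2 * c)%N by lia.
rewrite !lognM ?muln_gt0 ?fact_gt0 ?bin_gt0 ?le_c3 //.
have := logf 1%N isT; rewrite mul1n => ->; rewrite !logf //.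
move=> hlog; apply/negP => pdvd.
have: (0 < logn p 'C(3 * c, c))%N by rewrite logn_gt0 mem_primes hp bin_gt0 le_c3.
by lia.
Qed.

(** At most one of [u] and [v] is divisible by [p]; the other is prime to [p ^ s] and can be
    cancelled. *)
Lemma dvdz_pexp_mul_or (p : nat) (s : nat) (u v : int) :
  prime p -> ~~ (p %| u + v)%Z -> (p%:Z ^+ s %| u * v)%Z ->
  (p%:Z ^+ s %| u)%Z || (p%:Z ^+ s %| v)%Z.
Proof.
move=> hp hN hd.
have cop x : ~~ (p %| x)%Z -> coprimez (p%:Z ^+ s) x.
  by move=> ?; apply: coprimezXl; rewrite coprimezE /= prime_coprime.
have [pu|pu] := boolP (p %| u)%Z.
  have pv : ~~ (p %| v)%Z by apply: contra hN => pv; rewrite rpredD.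
  by rewrite Gauss_dvdzl ?cop // in hd; rewrite hd.
by rewrite Gauss_dvdzr ?cop // in hd; rewrite hd orbT.
Qed.

Lemma dvdz_sqr_prime (p : nat) (x : int) :
  prime p -> (p %| x ^+ 2)%Z = (p %| x)%Z.
Proof.
by move=> hp; rewrite !dvdzE /= abszX Euclid_dvdX // andbT.
Qed.

Lemma odd_intP (x : int) : ~~ (2 %| x)%Z -> exists y, x = 2 * y + 1.
Proof.
move=> ox; exists (x %/ 2)%Z; rewrite {1}(divz_eq x 2) mulrC; congr (_ + _).
move: ox; rewrite (sameP dvdz_mod0P eqP); have := modz_ge0 x (isT : 2 != 0 :> int).
by have := ltz_pmod x (isT : 0 < 2 :> int); case: (_ %% _)%Z => [[|[|]]|].
Qed.

(* The cross product [A * d - B * c] of two representations of [p ^+ s] is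
   divisible by [p ^+ s] up to replacing [d] by [- d], while its square is at
   most [p ^+ (2 * s)]; parity excludes the extreme case. *)
Lemma sum_two_squares_unique (p s : nat) (A B c d : int) :
  prime p -> odd p -> (0 < s)%N ->
  A ^+ 2 + B ^+ 2 = p%:Z ^+ s -> c ^+ 2 + d ^+ 2 = p%:Z ^+ s ->
  ~~ (p %| A)%Z -> ~~ (p %| c)%Z -> ~~ (2 %| A)%Z -> ~~ (2 %| c)%Z ->
  (A = c \/ A = - c) /\ (B = d \/ B = - d).
Proof.
move=> hp oddp s_gt0 hAB hcd pA pc oA oc.
have p_gt1 := prime_gt1 hp.
set N := p%:Z ^+ s in hAB hcd.
have N_gt0 : 0 < N by rewrite exprn_gt0 // ltz_nat; lia.
have pN : (p %| N)%Z by apply: dvdz_exp.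
have pd : ~~ (p %| d)%Z.
  apply: contra pc; rewrite -(dvdz_sqr_prime d hp) -(dvdz_sqr_prime c hp) => pd.
  by rewrite -(rpredDr _ pd) hcd.
have oN : ~~ (2 %| N)%Z.
  by rewrite /N dvdzE abszX Euclid_dvdX // s_gt0 andbT /= dvdn2 oddp.
have even_of (x y : int) : ~~ (2 %| x)%Z -> x ^+ 2 + y ^+ 2 = N -> (2 %| y)%Z.
  move=> ox hxy; apply: contraNT oN => oy; rewrite -hxy.
  have [[x' ->] [y' ->]] := (odd_intP ox, odd_intP oy).
  by apply/dvdzP; exists (2 * (x' ^+ 2 + x' + y' ^+ 2 + y') + 1); ring.
have eB := even_of _ _ oA hAB; have ed := even_of _ _ oc hcd.
have sq_eq (x y : int) : x ^+ 2 = y ^+ 2 -> x = y \/ x = - y.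
  by move/eqP; rewrite eqf_sqr => /orP[]/eqP->; [left | right].
have key d' : c ^+ 2 + d' ^+ 2 = N -> (2 %| d')%Z -> (N %| A * d' - B * c)%Z ->
    A ^+ 2 = c ^+ 2 /\ B ^+ 2 = d' ^+ 2.
  move=> hcd' ed' /dvdzP[k hk].
  (* Brahmagupta's identity. Since [A * c] is odd and [B * d'] even, the second square is positive,
     so the first is less than N^2, which forces [k = 0]. *)
  have hid : (A * d' - B * c) ^+ 2 + (A * c + B * d') ^+ 2 = N ^+ 2.
    by rewrite [in RHS]expr2 -{1}hAB -{1}hcd'; ring.
  have k0 : k = 0.
    case: (eqVneq k 0) => // k_neq0.
    have nz : A * c + B * d' != 0.
      apply: contraNneq oA => /eqP; rewrite addr_eq0 => /eqP hAc.
      have : (2 %| A * c)%Z by rewrite hAc rpredN dvdz_mull.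
      by rewrite !dvdzE !abszM Euclid_dvdM // -!dvdzE (negPf oc) orbF.
    move: hid; rewrite hk exprMn => hid.
    have N2_gt0 : 0 < N ^+ 2 by rewrite exprn_gt0.
    have k2_gt0 : 0 < k ^+ 2 by rewrite exprn_even_gt0.
    have nz2 : 0 < (A * c + B * d') ^+ 2 by rewrite exprn_even_gt0.
    by move: (N ^+ 2) (k ^+ 2) (_ ^+ 2) N2_gt0 k2_gt0 nz2 hid; clear; nia.
  have hz : A * d' = B * c by apply/eqP; rewrite -subr_eq0 hk k0 mul0r.
  have hA : A ^+ 2 = c ^+ 2.
    have : N * A ^+ 2 = N * c ^+ 2.
      rewrite -{1}hcd' -hAB mulrDl mulrDl.
      by rewrite -[d' ^+ 2 * _]exprMn [d' * A]mulrC hz exprMn; ring.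
    by apply: mulfI; rewrite gt_eqF.
  by split=> //; apply: (addrI (A ^+ 2)); rewrite hAB hA hcd'.
have hdvd : (N %| (A * d - B * c) * (A * d + B * c))%Z.
  have -> : (A * d - B * c) * (A * d + B * c) = N * (A ^+ 2 - c ^+ 2).
    by rewrite -subr_sqr !exprMn -(addKr (c ^+ 2) (d ^+ 2)) hcd
               -(addKr (A ^+ 2) (B ^+ 2)) hAB; ring.
  exact: dvdz_mulr.
(* The two factors add up to 2Ad, which is prime to [p], so N divides one of them entirely. *)
have p2Ad : ~~ (p %| (A * d - B * c) + (A * d + B * c))%Z.
  have -> : (A * d - B * c) + (A * d + B * c) = 2 * A * d by ring.
  rewrite dvdzE !abszM !Euclid_dvdM // !negb_or -!dvdzE pA pd andbT /=.
  rewrite andbT; apply/negP => /dvdn_leq; move: oddp p_gt1; case: (p) => [|[|[|]]] //= *; lia.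
case/orP: (dvdz_pexp_mul_or hp p2Ad hdvd) => h.
  by case: (key d hcd ed h) => /sq_eq ? /sq_eq.
case: (key (- d)); rewrite ?sqrrN ?rpredN //.
  by rewrite mulrN -opprD rpredN.
by move=> /sq_eq ? /sq_eq.
Qed.

(** Here the [e_i] stand for the Gauss periods, u + iv for the Jacobi sum, and the quadratic Gauss
    sum is -p^(2t). Combining the norm with the real part of G^2 = JR shows that p^t divides both
    components of G; the quotients A, B are then compared with a and 2b. *)
Lemma quartic_periods_aux (p t : nat) (e0 e1 e2 e3 u v a b : int) :
  prime p -> p = 1 %[mod 4] -> (0 < t)%N ->
  e0 + e1 + e2 + e3 = -1 ->
  e0 - e1 + e2 - e3 = - p%:Z ^+ (2 * t) ->
  (e0 - e2) ^+ 2 + (e1 - e3) ^+ 2 = p%:Z ^+ (4 * t) ->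
  (e0 - e2) ^+ 2 - (e1 - e3) ^+ 2 = u * (e0 - e1 + e2 - e3) ->
  2 * (e0 - e2) * (e1 - e3) = v * (e0 - e1 + e2 - e3) ->
  ~~ ((p %| u)%Z && (p %| v)%Z) ->
  a ^+ 2 + 4 * b ^+ 2 = p%:Z ^+ (2 * t) -> ~~ (p %| a)%Z -> ~~ (2 %| a)%Z ->
  perm_eq [:: -1 - 4 * e0; -1 - 4 * e1; -1 - 4 * e2; -1 - 4 * e3]
    [:: p%:Z ^+ (2 * t) + 2 * a * p%:Z ^+ t; p%:Z ^+ (2 * t) - 2 * a * p%:Z ^+ t;
        - p%:Z ^+ (2 * t) + 4 * b * p%:Z ^+ t;
        - p%:Z ^+ (2 * t) - 4 * b * p%:Z ^+ t].
Proof.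
move=> hp p1 t_gt0 hsum hR hN hu hv huv hab pa oa.
have p_gt1 := prime_gt1 hp.
have oddp : odd p by move: p1; clear; lia.
set s := p%:Z ^+ t.
have s_neq0 : s != 0 by rewrite expf_neq0 // -lt0n; apply: ltnW.
have hP : p%:Z ^+ (2 * t) = s ^+ 2 by rewrite /s -exprM mulnC.
have hP2 : p%:Z ^+ (4 * t) = s ^+ 4 by rewrite /s -exprM mulnC.
rewrite hR hP in hu hv; rewrite hP2 in hN.
have cop2 : coprimez (s ^+ 2) 2.
  by rewrite /s -exprM; apply: coprimezXl; rewrite coprimezE /= coprimen2.
have sdvd x y : 2 * x ^+ 2 = s ^+ 2 * y -> (s %| x)%Z.
  move=> h; rewrite -(@dvdz_pexp2r _ _ 2) // -(Gauss_dvdzr _ cop2) h.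
  exact: dvdz_mulr.
have /dvdzP[A hA] : (s %| e0 - e2)%Z.
  apply: (sdvd _ (s ^+ 2 - u)).
  have -> : 2 * (e0 - e2) ^+ 2 = s ^+ 4 + u * - s ^+ 2 by rewrite -hN -hu; ring.
  by ring.
have /dvdzP[B hB] : (s %| e1 - e3)%Z.
  apply: (sdvd _ (s ^+ 2 + u)).
  have -> : 2 * (e1 - e3) ^+ 2 = s ^+ 4 - u * - s ^+ 2 by rewrite -hN -hu; ring.
  by ring.
rewrite hA hB in hN hu hv.
have s2I : injective ( *%R (s ^+ 2)) by apply: mulfI; rewrite expf_neq0.
have hAB : A ^+ 2 + B ^+ 2 = s ^+ 2.
  by apply: s2I; rewrite -exprD -hN; ring.
have hu' : A ^+ 2 - B ^+ 2 = - u.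
  by apply: s2I; rewrite mulrN mulrC -mulNr -[in RHS]mulrC mulrN -mulrN -hu; ring.
have hv' : 2 * A * B = - v.
  by apply: s2I; rewrite mulrN mulrC -mulNr -[in RHS]mulrC mulrN -mulrN -hv; ring.
have ps : (p %| s ^+ 2)%Z by rewrite -hP dvdz_exp // muln_gt0.
have pA : ~~ (p %| A)%Z.
  (* If [p] divided A, it would divide B because A^2 + B^2 = s^2, and then both u = B^2 - A^2 and v
     = -2AB. *)
  apply: contra huv => pA.
  have pB : (p %| B)%Z.
    rewrite -(dvdz_sqr_prime _ hp) -(@rpredDl _ _ (A ^+ 2)) ?dvdz_sqr_prime //.
    by rewrite hAB.
  rewrite -[u]opprK -hu' -[v]opprK -hv' !rpredN rpredB ?dvdz_sqr_prime //=.
  by rewrite dvdz_mull.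
have oA : ~~ (2 %| A)%Z.
  (* As s^2 is 1 modulo 4, adding the two linear relations makes [e0 + e2] odd, hence also
     [e0 - e2 = A * s]. *)
  have [j hj] : exists j, s ^+ 2 = 4 * j + 1.
    exists (s ^+ 2 %/ 4)%Z; rewrite {1}(divz_eq (s ^+ 2) 4) mulrC; congr (_ + _).
    rewrite /s -exprM -[p%:Z]natz -natrX natz modz_nat.
    by rewrite -modnXm p1 modnXm exp1n.
  apply/negP => /dvdzP[A' hA']; move: hA hR; rewrite hP hj hA'.
  have -> : A' * 2 * s = 2 * (A' * s) by ring.
  by move: (A' * s) hsum; clear; lia.
have hab' : a ^+ 2 + (2 * b) ^+ 2 = p%:Z ^+ (2 * t) by rewrite -hab; ring.
rewrite -hP in hAB; have t2 : (0 < 2 * t)%N by rewrite muln_gt0.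
have [hAa hBb] := sum_two_squares_unique hp oddp t2 hAB hab' pA pa oA oa.
rewrite hP in hR *; clear -hAa hBb hA hB hR hsum.
have -> : -1 - 4 * e0 = s ^+ 2 - 2 * (A * s) by rewrite -hA -[-1]hsum -[s ^+ 2]opprK -hR; ring.
have -> : -1 - 4 * e2 = s ^+ 2 + 2 * (A * s) by rewrite -hA -[-1]hsum -[s ^+ 2]opprK -hR; ring.
have -> : -1 - 4 * e1 = - s ^+ 2 - 2 * (B * s) by rewrite -hB -[-1]hsum -hR; ring.
have -> : -1 - 4 * e3 = - s ^+ 2 + 2 * (B * s) by rewrite -hB -[-1]hsum -hR; ring.
rewrite -!(mulrA 2).
have -> : 4 * b * s = 2 * (2 * b * s) by ring.
by case: hAa => ->; case: hBb => ->; rewrite ?mulNr ?mulrN ?opprK;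
  apply/seq.permP => f /=; move: (f _) (f _) (f _) (f _); lia.
Qed.

(** Only the square of the quadratic Gauss sum is prescribed here, which leaves two signs to
    treat. *)
Lemma quartic_periods_perm (p t : nat) (e0 e1 e2 e3 u v a b : int) :
  prime p -> p = 1 %[mod 4] -> (0 < t)%N ->
  e0 + e1 + e2 + e3 = -1 ->
  (e0 - e1 + e2 - e3) ^+ 2 = p%:Z ^+ (4 * t) ->
  (e0 - e2) ^+ 2 + (e1 - e3) ^+ 2 = p%:Z ^+ (4 * t) ->
  (e0 - e2) ^+ 2 - (e1 - e3) ^+ 2 = u * (e0 - e1 + e2 - e3) ->
  2 * (e0 - e2) * (e1 - e3) = v * (e0 - e1 + e2 - e3) ->
  ~~ ((p %| u)%Z && (p %| v)%Z) ->
  a ^+ 2 + 4 * b ^+ 2 = p%:Z ^+ (2 * t) -> ~~ (p %| a)%Z -> ~~ (2 %| a)%Z ->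
  perm_eq [:: -1 - 4 * e0; -1 - 4 * e1; -1 - 4 * e2; -1 - 4 * e3]
    [:: p%:Z ^+ (2 * t) + 2 * a * p%:Z ^+ t; p%:Z ^+ (2 * t) - 2 * a * p%:Z ^+ t;
        - p%:Z ^+ (2 * t) + 4 * b * p%:Z ^+ t;
        - p%:Z ^+ (2 * t) - 4 * b * p%:Z ^+ t].
Proof.
move=> hp p1 t_gt0 hsum hR2 hN hu hv huv hab pa oa.
have hP2 : p%:Z ^+ (4 * t) = (p%:Z ^+ (2 * t)) ^+ 2 by rewrite -exprM; congr (_ ^+ _); clear; lia.
move/eqP: hR2; rewrite hP2 eqf_sqr => /orP[] /eqP hR; last first.
  exact: (quartic_periods_aux hp p1 t_gt0 hsum hR hN hu hv huv hab pa oa).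
(* Shifting the indices by one exchanges the two signs. *)
have swap (w x y z : int) : perm_eq [:: w; x; y; z] [:: x; w; z; y].
  by apply/seq.permP => f /=; move: (f _) (f _) (f _) (f _); clear; lia.
apply: perm_trans (swap _ _ _ _) _.
(* The exchange negates both the difference of squares and the quadratic sum, so [u] is kept; the
   product of the differences is unchanged, so [v] changes sign. *)
apply: (@quartic_periods_aux p t e1 e0 e3 e2 u (- v)); rewrite ?rpredN //.
- by rewrite -hsum; ring.
- by rewrite -hR; ring.
- by rewrite -hN; ring.
- by rewrite -opprB hu; ring.
- by rewrite mulrAC hv; ring.
Qed.

(** * Gauss and Jacobi sums *)

Lemma big_ord_mul (R : Type) (idx : R) (op : Monoid.law idx) (n k : nat)
    (F : nat -> R) :
  \big[op/idx]_(i < n * k) F i =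
  \big[op/idx]_(i < n) \big[op/idx]_(j < k) F (i * k + j)%N.
Proof.
rewrite -(big_mkord xpredT F) big_nat_mul big_mkord; apply: eq_bigr => i _.
by rewrite mulSn addnC -{1}[(i * k)%N]add0n big_addn addKn big_mkord;
  apply: eq_bigr => j _; rewrite addnC.
Qed.

Lemma big_unity_roots (F : finFieldType) (R : Type) (idx : R)
    (op : Monoid.com_law idx) (n : nat) (z : F) (f : F -> R) :
  n.-primitive_root z ->
  \big[op/idx]_(y | y ^+ n == 1) f y = \big[op/idx]_(s < n) f (z ^+ s).
Proof.
move=> hz; have inj : {in 'I_n &, injective (fun s : 'I_n => z ^+ s)}.
  move=> i j _ _ /eqP; rewrite (eq_prim_root_expr hz) !modn_small // => /eqP.
  exact: val_inj.
rewrite -(big_imset _ inj); apply: eq_bigl => y.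
apply/eqP/imsetP => [/(prim_rootP hz)[i ->]|[i _ ->]]; first by exists i.
by rewrite exprAC (prim_expr_order hz) expr1n.
Qed.

Lemma conj_unity_root (x : algC) (n : nat) : (0 < n)%N -> x ^+ n = 1 -> x^* = x^-1.
Proof.
move=> n_gt0 hx; rewrite invC_norm.
have -> : `|x| = 1.
  by apply/eqP; rewrite -(pexpr_eq1 n_gt0) ?normr_ge0 // -normrX hx normr1.
by rewrite expr1n invr1 mul1r.
Qed.

Lemma geometric_unity_root (R : idomainType) (x : R) (n : nat) :
  x ^+ n = 1 -> x != 1 -> \sum_(i < n) x ^+ i = 0.
Proof.
move=> hx x1; have /esym/eqP := subrX1 x n.
by rewrite hx subrr mulf_eq0 subr_eq0 (negPf x1) => /eqP.
Qed.

(** * The absolute trace and the additive characters of a finite field *)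

Section AbsoluteTrace.

Variables (K : finFieldType) (p m : nat).
Hypotheses (charK : p \in [pchar K]) (cardK : #|K| = (p ^ m)%N).

Let p_pr : prime p. Proof. by case/andP: charK. Qed.

Lemma pchar_exprD (i : nat) (x y : K) :
  (x + y) ^+ (p ^ i) = x ^+ (p ^ i) + y ^+ (p ^ i).
Proof. by rewrite exprDn_pchar // pnatX pnatE // charK. Qed.

Lemma pchar_expr_sum (I : Type) (r : seq I) (P : pred I) (f : I -> K) (i : nat) :
  (\sum_(j <- r | P j) f j) ^+ (p ^ i) = \sum_(j <- r | P j) f j ^+ (p ^ i).
Proof.
apply: (big_morph (fun x => x ^+ (p ^ i)) (pchar_exprD i)).
by rewrite expr0n expn_eq0 -leqn0 leqNgt prime_gt0.
Qed.

Lemma natr_pchar_expr (n i : nat) : (n%:R : K) ^+ (p ^ i) = n%:R.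
Proof.
elim: i => [|i IHi]; first by rewrite expr1.
by rewrite expnSr exprM IHi -(pFrobenius_autE charK) pFrobenius_aut_nat.
Qed.

Lemma trace_absD (x y : K) : trace_abs p m (x + y) = trace_abs p m x + trace_abs p m y.
Proof. by rewrite /trace_abs -big_split /=; apply: eq_bigr => i _; rewrite pchar_exprD. Qed.

Lemma trace_abs_natM (n : nat) (x : K) :
  trace_abs p m (n%:R * x) = n%:R * trace_abs p m x.
Proof.
by rewrite /trace_abs mulr_sumr; apply: eq_bigr => i _; rewrite exprMn natr_pchar_expr.
Qed.

Lemma natr_pchar_eq (i j : nat) : ((i%:R : K) == j%:R) = (i == j %[mod p]).
Proof.
wlog le_ij : i j / (i <= j)%N => [hw|].
  by case/orP: (leq_total i j) => /hw // h; rewrite eq_sym h eq_sym.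
by rewrite eq_sym -subr_eq0 -natrB // -(dvdn_pcharf charK) [RHS]eq_sym eqn_mod_dvd.
Qed.

(** The polynomial X^p - X already has the [p] roots [n%:R]; a further root would exceed its
    degree. *)
Lemma prime_subfieldP (y : K) : y ^+ p = y -> exists n : 'I_p, y = n%:R.
Proof.
move=> hy; have [/mapP[n _ ->]|hN] := boolP (y \in [seq (nat_of_ord n)%:R : K | n <- enum 'I_p]).
  by exists n.
pose P : {poly K} := 'X^p - 'X.
have szP : size P = p.+1.
  by rewrite size_polyDl size_polyXn // size_polyN size_polyX ltnS prime_gt1.
have: (size (y :: [seq (nat_of_ord n)%:R : K | n <- enum 'I_p]) < size P)%N.
  apply: max_poly_roots.
  - by rewrite -size_poly_gt0 szP.
  - rewrite /= rootE !hornerE hy subrr eqxx /=; apply/allP => _ /mapP[n _ ->].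
    by rewrite rootE !hornerE (natr_pchar_expr n 1 : _ ^+ p = _) subrr.
  - rewrite /= hN map_inj_uniq ?enum_uniq // => i j /eqP.
    by rewrite natr_pchar_eq !modn_small // => /eqP /val_inj.
by rewrite szP /= size_map size_enum_ord ltnn.
Qed.

(** Raising to the power [p] permutes the conjugates of [x] cyclically, since [x] to the power
    [p ^ m] is [x]. *)
Lemma trace_abs_prime_subfield (x : K) : exists n : 'I_p, trace_abs p m x = n%:R.
Proof.
apply: prime_subfieldP.
rewrite -[X in _ ^+ X]expn1 pchar_expr_sum /trace_abs.
under eq_bigr do rewrite -exprM -expnSr.
case: m cardK => [|m' hK]; first by rewrite !big_ord0.
rewrite big_ord_recr [RHS]big_ord_recl /=.
by rewrite -hK expf_card expr1 addrC.
Qed.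

(** The trace is a nonzero polynomial of degree at most p^(m-1), too small to vanish on all of
    [K]. *)
Lemma trace_abs_neq0 : exists x : K, trace_abs p m x != 0.
Proof.
apply/existsP; rewrite -negb_forall; apply/negP => /forallP h0.
have m_gt0 : (0 < m)%N.
  by move: (finNzRing_gt1 K); rewrite cardK; case: (m).
pose P : {poly K} := \sum_(i < m) 'X^(p ^ i).
have hP i : (i < m)%N -> P`_(p ^ i) = 1.
  move=> lt_im; rewrite coef_sum (bigD1 (Ordinal lt_im)) //= coefXn eqxx.
  rewrite big1 ?addr0 // => j; rewrite -val_eqE coefXn /= => neq_ji.
  by rewrite eqn_exp2l ?prime_gt1 // eq_sym (negPf neq_ji).
have P_neq0 : P != 0.
  apply/eqP => P0; have := hP 0%N m_gt0; rewrite P0 coef0 => /esym /eqP.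
  by rewrite oner_eq0.
have szP : (size P <= (p ^ m.-1).+1)%N.
  apply: (leq_trans (size_sum _ _ _)); apply/bigmax_leqP => i _.
  by rewrite size_polyXn ltnS leq_exp2l ?prime_gt1 // -ltnS prednK.
have: (size (enum K) < size P)%N.
  apply: max_poly_roots => //; last exact: enum_uniq.
  apply/allP => x _; rewrite rootE horner_sum.
  by under eq_bigr do rewrite hornerXn; apply: h0.
rewrite -cardE cardK => /leq_trans/(_ szP).
by rewrite ltnS leq_exp2l ?prime_gt1 // -{1}(prednK m_gt0) ltnn.
Qed.

Variable z : algC.
Hypothesis z_prim : p.-primitive_root z.

(** This is z^Tr(x), with the trace lifted from the prime field to its representative below [p]. The
    default exponent 0 is never reached, as the trace always lies in the prime field. *)
Definition add_char (x : K) : algC :=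
  z ^+ (if [pick n : 'I_p | trace_abs p m x == n%:R] is Some n then n : nat else 0%N).

Lemma add_charE (x : K) (n : nat) : trace_abs p m x = n%:R -> add_char x = z ^+ n.
Proof.
rewrite /add_char => hx; case: pickP => [i /eqP hi|h0].
  by apply/eqP; rewrite (eq_prim_root_expr z_prim) -natr_pchar_eq -hi hx.
have [i hi] := trace_abs_prime_subfield x.
by have := h0 i; rewrite hi eqxx.
Qed.

Lemma add_charD (x y : K) : add_char (x + y) = add_char x * add_char y.
Proof.
have [i hi] := trace_abs_prime_subfield x; have [j hj] := trace_abs_prime_subfield y.
rewrite (add_charE hi) (add_charE hj) -exprD; apply: add_charE.
by rewrite trace_absD hi hj natrD.
Qed.

Lemma add_char0 : add_char 0 = 1.
Proof.
rewrite (@add_charE 0 0) // /trace_abs big1 // => i _.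
by rewrite expr0n expn_eq0 -leqn0 leqNgt prime_gt0.
Qed.

Lemma add_charMn (n : nat) (x : K) : add_char (n%:R * x) = add_char x ^+ n.
Proof.
have [i hi] := trace_abs_prime_subfield x.
rewrite (add_charE hi) -exprM; apply: add_charE.
by rewrite trace_abs_natM hi -natrM mulnC.
Qed.

Lemma add_char_unity (x : K) : add_char x ^+ p = 1.
Proof. by rewrite -add_charMn (pcharf0 charK) mul0r add_char0. Qed.

Lemma add_char_neq0 (x : K) : add_char x != 0.
Proof.
have := add_char_unity x; case: eqVneq => // ->; rewrite expr0n.
by rewrite -leqn0 leqNgt prime_gt0 //= => /esym/eqP; rewrite oner_eq0.
Qed.

Lemma add_char_eq1 (x : K) : (add_char x == 1) = (trace_abs p m x == 0).
Proof.
have [i hi] := trace_abs_prime_subfield x.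
rewrite (add_charE hi) -(expr0 z) (eq_prim_root_expr z_prim) hi -[0]/(0%:R).
by rewrite natr_pchar_eq.
Qed.

Lemma add_charN (x : K) : add_char (- x) = (add_char x)^*.
Proof.
rewrite (conj_unity_root (prime_gt0 p_pr) (add_char_unity x)).
by apply: (mulIf (add_char_neq0 x)); rewrite -add_charD addNr add_char0 mulVf ?add_char_neq0.
Qed.

Lemma add_char_Aint (x : K) : add_char x \in Aint.
Proof. by rewrite /add_char rpredX // (Aint_prim_root z_prim). Qed.

(** For [y != 0], translating by an element of nonzero trace multiplies the sum by a factor other
    than 1, so the sum is zero. *)
Lemma sum_add_char (y : K) : \sum_x add_char (y * x) = (#|K| * (y == 0))%:R.
Proof.
have [->|y0] := eqVneq y 0.
  rewrite (eq_bigr (fun _ => 1)) => [|x _]; last by rewrite mul0r add_char0.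
  by rewrite sumr_const muln1.
rewrite muln0; have [x0] := trace_abs_neq0; rewrite -add_char_eq1 => hx0.
rewrite (_ : \sum_x _ = \sum_x add_char x); last by rewrite [RHS](reindex_inj (mulfI y0)).
have hS : \sum_x add_char x = add_char x0 * \sum_x add_char x.
  rewrite {1}(reindex_inj (addrI x0)) mulr_sumr.
  by apply: eq_bigr => x _; rewrite add_charD.
apply/eqP; move/eqP: hS; rewrite -subr_eq0 -{1}[\sum_x _]mul1r -mulrBl mulf_eq0.
by rewrite subr_eq0 eq_sym (negPf hx0).
Qed.

(** This turns the vanishing of a trace, and so the count of zero coordinates of a word, into a
    character sum. *)
Lemma sum_add_char_prime (x : K) :
  \sum_(n < p) add_char (n%:R * x) = (p * (trace_abs p m x == 0))%:R.
Proof.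
under eq_bigr do rewrite add_charMn.
rewrite -add_char_eq1; have [->|x1] := eqVneq (add_char x) 1.
  by under eq_bigr do rewrite expr1n; rewrite sumr_const card_ord muln1.
by rewrite muln0 geometric_unity_root // add_char_unity.
Qed.

End AbsoluteTrace.

(** The real and imaginary parts of i^d as integers, independent of the ring in which i is later
    interpreted. *)
Definition iexp (d : nat) : int * int := iter d (fun w => (- w.2, w.1)) (1, 0).

Lemma expr_iexp (R : comNzRingType) (j : R) (d : nat) :
  j ^+ 2 = -1 -> j ^+ d = (iexp d).1%:~R + j * (iexp d).2%:~R.
Proof.
move=> hj; elim: d => [|d IHd] /=; first by rewrite mulr0 addr0.
by rewrite exprS IHd mulrDr mulrA -expr2 hj rmorphN /=; ring.
Qed.

Lemma gaussian_int_inj (u v : int) :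
  (u%:~R + 'i * v%:~R = 0 :> algC) -> u = 0 /\ v = 0.
Proof.
move=> h; have : ((u ^+ 2 + v ^+ 2)%:~R = 0 :> algC).
  have -> : (u ^+ 2 + v ^+ 2)%:~R = (u%:~R + 'i * v%:~R) * (u%:~R - 'i * v%:~R) :> algC.
    by rewrite mulrC -subr_sqr exprMn sqrCi mulN1r opprK rmorphD /= !rmorphXn.
  by rewrite h mul0r.
move/eqP; rewrite intr_eq0 paddr_eq0 ?sqr_ge0 // !sqrf_eq0.
by case/andP=> /eqP -> /eqP ->.
Qed.

(** Translating by 1 leaves the sum of all elements unchanged but adds [#|K|] to it. *)
Lemma natr_card_field (K : finFieldType) : #|K|%:R = 0 :> K.
Proof.
apply: (addrI (\sum_(x : K) x)); rewrite addr0 [RHS](reindex_inj (addIr 1)).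
by rewrite big_split /= sumr_const.
Qed.

(** * Multiplicative characters, Gauss sums and Jacobi sums *)

Section MultiplicativeCharacters.

Variables (K : finFieldType) (n : nat) (g : K).
Hypotheses (cardK : #|K| = n.+1) (g_prim : n.-primitive_root g).

(** At 0 the value is a mere default; [mul_char] treats 0 separately. *)
Definition dlog (x : K) : nat :=
  if [pick i : 'I_n | x == g ^+ i] is Some i then i else 0.

(** The values lie in an arbitrary ring, so that one construction gives complex characters and also
    characters with values in [K] itself. *)
Definition mul_char (R : nzRingType) (w : R) (x : K) : R :=
  if x == 0 then 0 else w ^+ dlog x.

Lemma prim_expr_neq0 (e : nat) : g ^+ e != 0.
Proof.
rewrite expf_eq0 negb_and; apply/orP; right; apply/eqP => g0.
have := prim_expr_order g_prim; rewrite g0 expr0n -leqn0 leqNgt (prim_order_gt0 g_prim).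
by move/esym/eqP; rewrite oner_eq0.
Qed.

Lemma unity_neq0 (x : K) : (x ^+ n == 1) = (x != 0).
Proof.
have [->|x0] := eqVneq x 0.
  by rewrite expr0n -leqn0 leqNgt (prim_order_gt0 g_prim) eq_sym oner_eq0.
by rewrite -(inj_eq (mulfI x0)) -exprS -cardK expf_card mulr1 eqxx.
Qed.

Lemma dlogK (x : K) : x != 0 -> g ^+ dlog x = x.
Proof.
rewrite -unity_neq0 => /eqP /(prim_rootP g_prim)[i hi]; rewrite /dlog.
by case: pickP => [j /eqP <- //|/(_ i)]; rewrite hi eqxx.
Qed.

Lemma big_neq0 (R : Type) (idx : R) (op : Monoid.com_law idx) (f : K -> R) :
  \big[op/idx]_(x | x != 0) f x = \big[op/idx]_(e < n) f (g ^+ e).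
Proof. by rewrite -(big_unity_roots op f g_prim); apply: eq_bigl => x; rewrite unity_neq0. Qed.

Section Values.

Variables (R : nzRingType) (w : R).
Hypothesis w_unity : w ^+ n = 1.

Lemma mul_charX (e : nat) : mul_char w (g ^+ e) = w ^+ e.
Proof.
rewrite /mul_char (negPf (prim_expr_neq0 e)).
have := dlogK (prim_expr_neq0 e); move/eqP; rewrite (eq_prim_root_expr g_prim).
by move=> /eqP he; rewrite -[LHS](expr_mod _ w_unity) he expr_mod.
Qed.

Lemma mul_char0 : mul_char w 0 = 0.
Proof. by rewrite /mul_char eqxx. Qed.

Lemma mul_char1 : mul_char w 1 = 1.
Proof. by rewrite -(expr0 g) mul_charX expr0. Qed.

Lemma mul_charM (x y : K) : mul_char w (x * y) = mul_char w x * mul_char w y.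
Proof.
have [->|x0] := eqVneq x 0; first by rewrite mul0r mul_char0 mul0r.
have [->|y0] := eqVneq y 0; first by rewrite mulr0 mul_char0 mulr0.
by rewrite -(dlogK x0) -(dlogK y0) -exprD !mul_charX exprD.
Qed.

Lemma mul_char_sqr (x : K) : mul_char w x * mul_char w x = mul_char (w ^+ 2) x.
Proof.
by rewrite /mul_char; case: ifP => _; rewrite ?mul0r // -exprD -exprM addnn mul2n.
Qed.

End Values.

Lemma sum_mul_char (R : idomainType) (w : R) :
  w ^+ n = 1 -> w != 1 -> \sum_x mul_char w x = 0.
Proof.
move=> w_unity w1; rewrite (bigD1 0) //= mul_char0 // add0r big_neq0.
under eq_bigr do rewrite mul_charX //.
exact: geometric_unity_root.
Qed.

Lemma mul_char_conj (w : algC) (x : K) :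
  w ^+ n = 1 -> x != 0 -> mul_char w x * (mul_char w x)^* = 1.
Proof.
move=> w_unity x0; have n_gt0 := prim_order_gt0 g_prim.
rewrite (@conj_unity_root _ n) // ?mulfV //.
  have : mul_char w x ^+ n = 1.
    by rewrite -(dlogK x0) mul_charX // exprAC w_unity expr1n.
  case: eqVneq => // ->; rewrite expr0n -leqn0 leqNgt n_gt0 => /esym/eqP.
  by rewrite oner_eq0.
by rewrite -(dlogK x0) mul_charX // exprAC w_unity expr1n.
Qed.

(** If [n] divides [j], every nonzero [x] contributes 1, and [n] = -1 in [K]; otherwise the sum over
    the powers of [g] is a geometric sum equal to 0. *)
Lemma sum_expr_field (j : nat) : (0 < j)%N -> \sum_(x : K) x ^+ j = - (n %| j)%:R.
Proof.
move=> j_gt0; rewrite (bigD1 0) //= expr0n -leqn0 leqNgt j_gt0 add0r big_neq0.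
under eq_bigr do rewrite exprAC.
rewrite (prim_order_dvd g_prim); have [->|gj1] := eqVneq (g ^+ j) 1.
  under eq_bigr do rewrite expr1n.
  rewrite sumr_const card_ord; apply/eqP; rewrite -addr_eq0 -natrD addn1 -cardK.
  by rewrite natr_card_field.
by rewrite oppr0 geometric_unity_root // exprAC (prim_expr_order g_prim) expr1n.
Qed.

Section GaussSums.

Variables (p m : nat) (z : algC).
Hypotheses (charK : p \in [pchar K]) (cardKp : #|K| = (p ^ m)%N).
Hypothesis z_prim : p.-primitive_root z.

Local Notation psi := (add_char p m z).

Definition gauss_sum (w : algC) : algC := \sum_(x : K) mul_char w x * psi x.

Definition jacobi_sum (w : algC) : algC :=
  \sum_(x : K) mul_char w x * mul_char w (1 - x).

(** Replacing [x] by [x * y] in one factor makes the double sum an additive character sum over [y],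
    and orthogonality leaves only [x = 1]. *)
Lemma gauss_sum_norm (w : algC) : w ^+ n = 1 -> w != 1 ->
  gauss_sum w * (gauss_sum w)^* = #|K|%:R.
Proof.
move=> w_unity w1; rewrite mulrC rmorph_sum mulr_suml /=.
rewrite (bigD1 0) //= mul_char0 mul0r rmorph0 mul0r add0r.
have step y : y != 0 -> (mul_char w y * psi y)^* * gauss_sum w =
    \sum_x mul_char w x * psi ((x - 1) * y).
  move=> y0; rewrite /gauss_sum (reindex_inj (mulIf y0)) mulr_sumr.
  apply: eq_bigr => x _; rewrite mul_charM // rmorphM /= -(add_charN charK cardKp z_prim).
  rewrite mulrBl mul1r (add_charD charK cardKp z_prim).
  transitivity ((mul_char w y * (mul_char w y)^*) *
                (mul_char w x * (psi (x * y) * psi (- y)))); first by ring.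
  by rewrite mul_char_conj // mul1r.
rewrite (eq_bigr _ step) exchange_big /=.
(* The term -w(x) compensates for the missing [y = 0]; summed over [x] it vanishes. *)
have inner x : \sum_(y | y != 0) mul_char w x * psi ((x - 1) * y) =
    #|K|%:R * (if x == 1 then mul_char w x else 0) - mul_char w x.
  rewrite -mulr_sumr; have := sum_add_char charK cardKp z_prim (x - 1).
  rewrite (bigD1 0) //= mulr0 (add_char0 charK cardKp z_prim) => /(canRL (addKr _)) ->.
  by rewrite subr_eq0; case: (x == 1); rewrite ?muln1 ?muln0; ring.
rewrite (eq_bigr _ (fun x _ => inner x)) sumrB -mulr_sumr sum_mul_char // subr0.
by rewrite -big_mkcond big_pred1_eq mul_char1 // mulr1.
Qed.

(** Pairs are grouped by their sum [s]. For [s != 0], scaling by [s] extracts the Jacobi sum and the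
    value of the squared character at [s]. *)
Lemma gauss_sum_sqr (w : algC) : w ^+ n = 1 -> w ^+ 2 != 1 ->
  gauss_sum w ^+ 2 = jacobi_sum w * gauss_sum (w ^+ 2).
Proof.
move=> w_unity w21.
have w2_unity : (w ^+ 2) ^+ n = 1 by rewrite exprAC w_unity expr1n.
rewrite expr2 {1}/gauss_sum mulr_suml.
transitivity (\sum_x \sum_s mul_char w x * mul_char w (s - x) * psi s).
  apply: eq_bigr => x _; rewrite [RHS](reindex_inj (addrI x)) mulr_sumr.
  apply: eq_bigr => y _ /=; rewrite addrAC subrr add0r (add_charD charK cardKp z_prim).
  by ring.
rewrite exchange_big mulr_sumr; apply: eq_bigr => s _ /=; rewrite -mulr_suml mulrA.
congr (_ * _); have [->|s0] := eqVneq s 0.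
  rewrite mul_char0 // mulr0.
  (* For [s = 0] the inner sum is a full sum of the squared character, which is nontrivial. *)
  transitivity (mul_char w (-1) * \sum_x mul_char (w ^+ 2) x); last first.
    by rewrite sum_mul_char // mulr0.
  rewrite mulr_sumr; apply: eq_bigr => x _.
  by rewrite sub0r -[- x]mulN1r mul_charM // -mul_char_sqr //; ring.
rewrite (reindex_inj (mulfI s0)) mulr_suml; apply: eq_bigr => x _ /=.
rewrite -[X in X - _](mulr1 s) -mulrBr !mul_charM // -mul_char_sqr //.
by ring.
Qed.

End GaussSums.

End MultiplicativeCharacters.

(** * The irreducible cyclic code of index 4 *)

(** When [4 * c] is the order of the multiplicative group, the solutions of [y ^+ c = 1] are the
    nonzero fourth powers, and this is the weight of the word of [x] in the code of index 4. *)
Definition coset_weight (K : finFieldType) (p m c : nat) (x : K) : nat :=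
  #|[set y : K | (y ^+ c == 1) && (trace_abs p m (x * y) != 0)]|.

Lemma coset_weight0 (K : finFieldType) (p m c : nat) :
  (0 < p)%N -> coset_weight p m c (0 : K) = 0%N.
Proof.
move=> p_gt0; apply: eq_card0 => y; rewrite inE mul0r /trace_abs big1 ?eqxx ?andbF //.
by move=> i _; rewrite expr0n expn_eq0 -leqn0 leqNgt p_gt0.
Qed.

Lemma coset_weightM (K : finFieldType) (p m c : nat) (x u : K) :
  u ^+ c = 1 -> u != 0 -> coset_weight p m c (x * u) = coset_weight p m c x.
Proof.
move=> hu u0; rewrite /coset_weight -(card_imset _ (mulfI u0)).
apply: eq_card => y; rewrite inE; apply/imsetP/andP => [[y' hy' ->]|[hy tr_y]].
  by move: hy'; rewrite inE exprMn hu mul1r mulrA => /andP.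
exists (y / u); last by rewrite mulrC divfK.
by rewrite inE exprMn exprVn hu invr1 mulr1 hy -mulrA [u * _]mulrC divfK.
Qed.

(** * Quartic Gauss periods and the four nonzero weights *)

Section QuarticPeriods.

Variables (K : finFieldType) (p t c : nat) (g : K).
Hypotheses (charK : p \in [pchar K]) (p1 : p = 1 %[mod 4]) (t_gt0 : (0 < t)%N).
Hypotheses (cardK : #|K| = (p ^ (4 * t))%N) (q_c : (p ^ (4 * t) = 4 * c + 1)%N).
Hypothesis g_prim : (4 * c).-primitive_root g.

Let p_pr : prime p. Proof. by case/andP: charK. Qed.

Let cardK1 : #|K| = (4 * c).+1. Proof. by rewrite cardK q_c addn1. Qed.

Let c_gt0 : (0 < c)%N.
Proof. by have := prim_order_gt0 g_prim; rewrite muln_gt0. Qed.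

Let g4_prim : c.-primitive_root (g ^+ 4).
Proof. by have := dvdn_prim_root g_prim (dvdn_mull 4 (dvdnn c)); rewrite mulnK. Qed.

(** The quotient (q - 1)/(p - 1) is a sum of 4t powers of [p], each 1 modulo 4. It is thus divisible
    by 4, so p - 1 divides [c]. *)
Lemma natr_quartic (n : nat) : (n%:R : K) != 0 -> (n%:R : K) ^+ c = 1.
Proof.
move=> n0; have hp1 : (n%:R : K) ^+ p.-1 = 1.
  apply: (mulfI n0); rewrite -exprS prednK ?prime_gt0 // mulr1.
  exact: (natr_pchar_expr charK n 1).
have [d ->] : exists d, c = (p.-1 * d)%N.
  have := predn_exp p (4 * t); rewrite q_c addn1 /= big_ord_mul => hd.
  have /dvdnP[d hd4] : (4 %| \sum_(i < 4) \sum_(j < t) p ^ (i * t + j))%N.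
    rewrite exchange_big /=; apply: dvdn_sum => j _.
    rewrite /dvdn -modn_summ.
    under eq_bigr do rewrite -modnXm p1 modnXm exp1n.
    by rewrite sum_nat_const card_ord.
  exists d; apply/eqP; rewrite -(eqn_pmul2l (isT : 0 < 4)%N) hd hd4.
  by apply/eqP; ring.
by rewrite exprM hp1 expr1n.
Qed.

Variable z : algC.
Hypothesis z_prim : p.-primitive_root z.

Local Notation psi := (add_char p (4 * t) z).
Local Notation wt := (@coset_weight K p (4 * t) c).

Definition gauss_period (x : K) : algC := \sum_(y | y ^+ c == 1) psi (x * y).

Lemma gauss_periodM (x u : K) : u != 0 -> u ^+ c = 1 -> gauss_period (x * u) = gauss_period x.
Proof.
move=> u0 hu; rewrite /gauss_period [RHS](reindex_inj (mulfI u0)).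
by apply: eq_big => y; rewrite ?exprMn ?hu ?mul1r // mulrA.
Qed.

Lemma card_unity_roots : #|[set y : K | y ^+ c == 1]| = c.
Proof.
rewrite -sum1_card; under eq_bigl do rewrite inE.
by rewrite (big_unity_roots _ _ g4_prim) sum1_card card_ord.
Qed.

(** The sum of psi(nxy) over n < p and y in the group of fourth powers is evaluated twice. Summing
    over n first counts the zero traces; summing over y first gives [c] for n = 0 and the period
    itself for every other n, since n is then a fourth power. *)
Lemma gauss_period_weight (x : K) :
  (p%:R - 1) * gauss_period x = p%:R * (c%:R - (wt x)%:R) - c%:R.
Proof.
have hE : \sum_(n < p) \sum_(y | y ^+ c == 1) psi (n%:R * (x * y)) =
          p%:R * (c%:R - (wt x)%:R).
  rewrite exchange_big /=.
  under eq_bigr do rewrite (sum_add_char_prime charK cardK z_prim) natrM.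
  rewrite -mulr_sumr -natr_sum; congr (_ * _); apply/eqP; rewrite eq_sym subr_eq.
  rewrite -natrD eqr_nat -{1}card_unity_roots /coset_weight.
  rewrite -!sum1_card big_mkcond /= [X in _ == (X + _)%N]big_mkcond.
  rewrite [X in _ == (_ + X)%N]big_mkcond -big_split /=.
  apply/eqP/eq_bigr => y _; rewrite !inE; case: (_ == 1) => //=.
  by case: (_ == 0).
rewrite -hE (bigD1 (Ordinal (prime_gt0 p_pr))) //=.
rewrite (eq_bigr (fun _ => 1)); last by move=> y _; rewrite mul0r (add_char0 charK cardK z_prim).
have -> : \sum_(y : K | y ^+ c == 1) 1 = c%:R :> algC.
  rewrite -[in RHS]card_unity_roots -sum1_card natr_sum; apply: eq_bigl => y.
  by rewrite inE.
rewrite (eq_bigr (fun _ => gauss_period x)); last first.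
  move=> n hn; have n0 : (n%:R : K) != 0.
    rewrite -(dvdn_pcharf charK); apply: contra hn => /dvdnP[d hd].
    rewrite -val_eqE /= hd; have := ltn_ord n; rewrite hd.
    by case: (d) => [|d'] //; rewrite mulSn ltnNge leq_addr.
  rewrite -(gauss_periodM x n0 (natr_quartic n0)); apply: eq_bigr => y _.
  by congr psi; ring.
rewrite sumr_const cardC1 card_ord -(mulr_natl (gauss_period x)) -subn1 natrB ?prime_gt0 //.
by ring.
Qed.

(** The period is rational by its relation to the weight, and it is a sum of roots of unity, hence
    an algebraic integer. *)
Lemma gauss_period_int (x : K) : exists e : int, gauss_period x = e%:~R.
Proof.
apply/intrP/Cint_rat_Aint; last first.
  by apply: rpred_sum => y _; apply: add_char_Aint.
have p1_neq0 : (p%:R - 1 : algC) != 0.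
  by rewrite subr_eq0 -[1]/(1%:R) eqr_nat; have := prime_gt1 p_pr; case: (p) => [|[]].
rewrite -[gauss_period x](mulKf p1_neq0) gauss_period_weight.
by rewrite rpredM ?rpredV ?rpredB ?rpredM ?rpredB ?rpred_nat ?rpred1.
Qed.

(** Every nonzero element is g^(4s+k) with k < 4, and [w] only sees k. *)
Lemma gauss_sum_periods (w : algC) : w ^+ 4 = 1 ->
  gauss_sum (4 * c) g p (4 * t) z w = \sum_(k < 4) w ^+ k * gauss_period (g ^+ k).
Proof.
move=> w4; have wn : w ^+ (4 * c) = 1 by rewrite exprM w4 expr1n.
rewrite /gauss_sum (bigD1 0) //= mul_char0 // mul0r add0r (big_neq0 cardK1 g_prim).
rewrite (eq_bigr (fun e : 'I_(4 * c) => w ^+ e * psi (g ^+ e))); last first.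
  by move=> e _; rewrite (mul_charX cardK1 g_prim wn e).
rewrite -(big_mkord xpredT (fun e => w ^+ e * psi (g ^+ e))) mulnC big_mkord.
rewrite (big_ord_mul _ _ _ (fun e => w ^+ e * psi (g ^+ e))) exchange_big /=.
apply: eq_bigr => k _; rewrite /gauss_period (big_unity_roots _ _ g4_prim) mulr_sumr.
apply: eq_bigr => s _; rewrite !exprD mulnC !exprM w4 expr1n mul1r.
by rewrite [g ^+ k * _]mulrC.
Qed.

Lemma sum_gauss_periods : \sum_(k < 4) gauss_period (g ^+ k) = -1.
Proof.
(* For the trivial character the Gauss sum is the complete additive sum, which is 0, without its
   term 1 at the origin. *)
have <- : gauss_sum (4 * c) g p (4 * t) z 1 = -1.
  rewrite /gauss_sum; have := sum_add_char charK cardK z_prim 1.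
  rewrite oner_eq0 muln0 (bigD1 0) //= mulr0 (add_char0 charK cardK z_prim).
  move/(canRL (addKr _)); rewrite addr0 => <-; rewrite (bigD1 0) //= mul_char0 // mul0r add0r.
  by apply: eq_bigr => x x0; rewrite /mul_char (negPf x0) expr1n !mul1r.
by rewrite gauss_sum_periods ?expr1n //; apply: eq_bigr => k _; rewrite expr1n mul1r.
Qed.

Let jac_exp (x : K) := (dlog (4 * c) g x + dlog (4 * c) g (1 - x)%R)%N.
Let jac_re := \sum_(x : K | (x != 0) && (1 - x != 0)) (iexp (jac_exp x)).1.
Let jac_im := \sum_(x : K | (x != 0) && (1 - x != 0)) (iexp (jac_exp x)).2.

(* The same pair of integers describes the Jacobi sum in every ring with a
   square root of -1, in particular in K itself. *)
Lemma jacobi_sum_gaussian (R : comNzRingType) (j : R) : j ^+ 2 = -1 ->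
  \sum_(x : K) mul_char (4 * c) g j x * mul_char (4 * c) g j (1 - x) =
  jac_re%:~R + j * jac_im%:~R.
Proof.
move=> hj; rewrite [jac_re%:~R]rmorph_sum [jac_im%:~R]rmorph_sum /= mulr_sumr -big_split /=.
rewrite [RHS]big_mkcond; apply: eq_bigr => x _; rewrite /mul_char.
case: (x == 0); first by rewrite mul0r.
case: (1 - x == 0); first by rewrite mulr0.
by rewrite -exprD (expr_iexp _ hj).
Qed.

(** After binomial expansion the power sum of exponent 3c + k survives only when 4c divides it; as 0
    <= k <= 3c, this means k = c. *)
Lemma sum_quartic_powers :
  \sum_(x : K) x ^+ (3 * c) * (1 - x) ^+ (3 * c) = - ((-1) ^+ c * 'C(3 * c, c)%:R).
Proof.
transitivity (\sum_(x : K) \sum_(k < (3 * c).+1)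
    (-1) ^+ k * 'C(3 * c, k)%:R * x ^+ (3 * c + k)).
  apply: eq_bigr => x _; rewrite exprDn mulr_sumr; apply: eq_bigr => k _.
  by rewrite expr1n mul1r (exprNn x) exprD [LHS]mulrnAr [in LHS]mulrCA -[LHS]mulr_natr mulrAC.
rewrite exchange_big /=.
have lt_c : (c < (3 * c).+1)%N by lia.
rewrite (bigD1 (Ordinal lt_c)) //= -mulr_sumr (sum_expr_field cardK1 g_prim); last by lia.
have -> : (4 * c %| 3 * c + c)%N by rewrite -mulSnr.
rewrite big1 ?addr0 ?mulrN ?mulr1 // => k; rewrite -val_eqE /= => neq_kc.
rewrite -mulr_sumr (sum_expr_field cardK1 g_prim); last by lia.
have -> : (4 * c %| 3 * c + k)%N = false.
  apply/negP => /dvdnP[d hd]; move/negP: neq_kc; apply; apply/eqP.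
  by have := ltn_ord k; move: hd c_gt0; clear; case: d => [|[|d]]; nia.
by rewrite oppr0 mulr0.
Qed.

(** Evaluating the Gaussian integer in [K] realises the reduction modulo a prime above [p]: there it
    becomes a binomial coefficient up to sign, which is nonzero. *)
Lemma jacobi_sum_Ndvd : ~~ ((p %| jac_re)%Z && (p %| jac_im)%Z).
Proof.
apply/negP => /andP[/dvdzP[u hu] /dvdzP[v hv]].
(* With this square root of -1 the character is x^(3c). The other root [g ^+ c] would give x^c (1 -
   x)^c, whose degree 2c is too small for a nonzero sum. *)
pose j := g ^+ (3 * c).
have hj : j ^+ 2 = -1.
  have : (j ^+ 2) ^+ 2 == 1.
    by rewrite -!exprM -(prim_order_dvd g_prim); apply/dvdnP; exists 3; lia.
  rewrite sqrf_eq1 => /orP[|/eqP //]; rewrite -exprM -(prim_order_dvd g_prim).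
  by move=> /dvdnP[d hd]; have : (6 = d * 4)%N; [move: hd c_gt0; clear; nia | lia].
have jn : j ^+ (4 * c) = 1 by rewrite exprAC (prim_expr_order g_prim) expr1n.
have mcE x : mul_char (4 * c) g j x = x ^+ (3 * c).
  have [->|x0] := eqVneq x 0.
    by rewrite mul_char0 // expr0n muln_eq0 /= eqn0Ngt c_gt0.
  by rewrite -(dlogK cardK1 g_prim x0) (mul_charX cardK1 g_prim jn) exprAC.
have := jacobi_sum_gaussian hj; rewrite hu hv !intrM.
rewrite -pmulrn (pcharf0 charK) !mulr0 addr0.
under eq_bigr do rewrite !mcE.
rewrite sum_quartic_powers => /eqP; rewrite oppr_eq0 mulf_eq0 signr_eq0 /=.
rewrite -(dvdn_pcharf charK); apply/negP.
exact: bin_repunit4_Ndvd q_c.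
Qed.

(** The assertion is up to order because changing the sign of [a] or [b] only permutes the four
    values. *)
Lemma quartic_weights_perm (a b : int) :
  a ^+ 2 + 4 * b ^+ 2 = p%:Z ^+ (2 * t) -> ~~ (p %| a)%Z -> ~~ (2 %| a)%Z ->
  perm_eq [seq (wt (g ^+ k))%:R : rat | k <- iota 0 4]
    [:: wgt p t a b 1 0 0 0; wgt p t a b 0 1 0 0;
        wgt p t a b 0 0 1 0; wgt p t a b 0 0 0 1].
Proof.
move=> hab pa oa.
have [[e0 h0] [e1 h1]] := (gauss_period_int (g ^+ 0), gauss_period_int (g ^+ 1)).
have [[e2 h2] [e3 h3]] := (gauss_period_int (g ^+ 2), gauss_period_int (g ^+ 3)).
have sum4 (f : nat -> algC) : \sum_(k < 4) f k = f 0%N + f 1%N + f 2 + f 3.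
  by rewrite !big_ord_recr big_ord0 /= add0r.
have i4 : 'i ^+ 4 = 1 :> algC by rewrite (exprM 'i 2 2) sqrCi sqrrN expr1n.
have m4 : (-1) ^+ 4 = 1 :> algC by rewrite -signr_odd.
have in4 : 'i ^+ (4 * c) = 1 :> algC by rewrite exprM i4 expr1n.
have mn4 : (-1) ^+ (4 * c) = 1 :> algC by rewrite exprM m4 expr1n.
have m1 : -1 != 1 :> algC by rewrite eq_sym -subr_eq0 opprK -(natrD _ 1 1) pnatr_eq0.
have i1 : 'i != 1 :> algC by apply: contraNneq m1 => hi; rewrite -sqrCi hi expr1n.
have GI : gauss_sum (4 * c) g p (4 * t) z 'i = (e0 - e2)%:~R + 'i * (e1 - e3)%:~R.
  rewrite gauss_sum_periods // (sum4 (fun k => 'i ^+ k * gauss_period (g ^+ k))).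
  by rewrite h0 h1 h2 h3 (exprS _ 2) sqrCi !rmorphB /=; ring.
have GR : gauss_sum (4 * c) g p (4 * t) z (-1) = (e0 - e1 + e2 - e3)%:~R.
  rewrite gauss_sum_periods // (sum4 (fun k => (-1) ^+ k * gauss_period (g ^+ k))).
  by rewrite h0 h1 h2 h3 (exprS _ 2) sqrrN expr1n !(rmorphB, rmorphD) /=; ring.
have qZ : (#|K|%:R : algC) = (p%:Z ^+ (4 * t))%:~R by rewrite cardK natrX [RHS]rmorphXn.
have hsum : e0 + e1 + e2 + e3 = -1.
  have := sum_gauss_periods; rewrite (sum4 (fun k => gauss_period (g ^+ k))) h0 h1 h2 h3.
  by rewrite -!rmorphD -[-1]/((-1)%:~R) => /intr_inj.
have hR2 : (e0 - e1 + e2 - e3) ^+ 2 = p%:Z ^+ (4 * t).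
  have := gauss_sum_norm cardK1 g_prim charK cardK z_prim mn4 m1.
  rewrite GR (conj_intr _) // -rmorphM qZ => /intr_inj <-.
  by rewrite expr2.
have hN : (e0 - e2) ^+ 2 + (e1 - e3) ^+ 2 = p%:Z ^+ (4 * t).
  have := gauss_sum_norm cardK1 g_prim charK cardK z_prim in4 i1.
  have -> : (gauss_sum (4 * c) g p (4 * t) z 'i)^* = (e0 - e2)%:~R - 'i * (e1 - e3)%:~R.
    by rewrite GI [LHS]rmorphD [X in _ + X]rmorphM /= conjCi !(conj_intr _) // mulNr.
  rewrite GI qZ mulrC -subr_sqr.
  by rewrite exprMn sqrCi mulN1r opprK -!rmorphXn -rmorphD => /intr_inj.
have i21 : 'i ^+ 2 != 1 :> algC by rewrite sqrCi.
have := gauss_sum_sqr cardK1 g_prim charK cardK z_prim in4 i21.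
rewrite /jacobi_sum (jacobi_sum_gaussian (sqrCi _)) [in gauss_sum _ _ _ _ _ (_ ^+ 2)]sqrCi.
rewrite GR GI => hJ.
(* Real and imaginary parts of G^2 = JR. *)
have [hu hv] : (e0 - e2) ^+ 2 - (e1 - e3) ^+ 2 - jac_re * (e0 - e1 + e2 - e3) = 0 /\
    2 * (e0 - e2) * (e1 - e3) - jac_im * (e0 - e1 + e2 - e3) = 0.
  apply: gaussian_int_inj; move/eqP: hJ; rewrite -subr_eq0 => /eqP <-.
  move: (e0 - e2) (e1 - e3) (e0 - e1 + e2 - e3) => X Y R.
  rewrite [X in _ = X - _]sqrrD [('i * _) ^+ 2]exprMn sqrCi.
  by rewrite !(rmorphB, rmorphM, rmorphXn) /=; ring.
move/eqP: hu; rewrite subr_eq0 => /eqP hu; move/eqP: hv; rewrite subr_eq0 => /eqP hv.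
have := quartic_periods_perm p_pr p1 t_gt0 hsum hR2 hN hu hv jacobi_sum_Ndvd hab pa oa.
(* Solving [gauss_period_weight] for the weight gives (p - 1)/(4p) times (q - 1 - 4 eta). *)
pose h (x : int) : rat := (p%:Q - 1) / (4 * p%:Q) * ((p ^ (4 * t))%N%:Q + x%:~R).
move/(perm_map h) => /=.
have p_neq0 : p%:Q != 0 by rewrite intr_eq0 -lt0n prime_gt0.
have wE k e : gauss_period (g ^+ k) = e%:~R -> h (-1 - 4 * e) = (wt (g ^+ k))%:R.
  move=> he; have := gauss_period_weight (g ^+ k); rewrite he => hw.
  have hw' : (p%:Z - 1) * e = p%:Z * (c%:Z - (wt (g ^+ k))%:Z) - c%:Z.
    by apply: (@intr_inj algC); rewrite !(rmorphB, rmorphM) /= -!pmulrn.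
  have : ((p%:Z - 1) * e)%:~R = (p%:Z * (c%:Z - (wt (g ^+ k))%:Z) - c%:Z)%:~R :> rat.
    by rewrite hw'.
  rewrite !(rmorphB, rmorphM) /= -!pmulrn rmorph1 => hq.
  have -> : h (-1 - 4 * e) = ((p%:R - 1) * c%:R - (p%:R - 1) * e%:~R) / p%:R.
    by rewrite /h q_c -!pmulrn natrD natrM !(rmorphB, rmorphM) /=; field.
  by rewrite hq; field.
rewrite (wE 0%N) // (wE 1%N) // (wE 2) // (wE 3) // => /perm_trans; apply.
have eq_perm (s1 s2 : seq rat) : s1 = s2 -> perm_eq s1 s2 by move=> ->.
apply: eq_perm; congr [:: _; _; _; _]; rewrite /h /wgt /= -[p%:Z]natz -!natrX !natz;
  by rewrite !(rmorphB, rmorphM, rmorphD) /= ?mul1n ?mul0n; ring.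
Qed.

End QuarticPeriods.

(** * Reduction to the code of index 4 *)

(** The multinomial coefficient with fifth part r - h, in the form produced by iterating the
    binomial theorem; it vanishes when h exceeds [r]. *)
Definition bin4 (r l1 l2 l3 l4 : nat) : nat :=
  ('C(r, l1) * 'C(r - l1, l2) * 'C(r - l1 - l2, l3) * 'C(r - l1 - l2 - l3, l4))%N.

Lemma bin4_fact (r l1 l2 l3 l4 : nat) : (l1 + l2 + l3 + l4 <= r)%N ->
  (bin4 r l1 l2 l3 l4 * (l1`! * l2`! * l3`! * l4`!) * (r - (l1 + l2 + l3 + l4))`! = r`!)%N.
Proof.
move=> hr; rewrite /bin4.
rewrite -(@bin_fact r l1); last by lia.
rewrite -(@bin_fact (r - l1) l2); last by lia.
rewrite -(@bin_fact (r - l1 - l2) l3); last by lia.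
rewrite -(@bin_fact (r - l1 - l2 - l3) l4); last by lia.
by rewrite !subnDA; ring.
Qed.

Lemma bin4_eq0 (r l1 l2 l3 l4 : nat) :
  ~~ (l1 + l2 + l3 + l4 <= r)%N -> bin4 r l1 l2 l3 l4 = 0%N.
Proof.
move=> hr; rewrite /bin4.
have [h1|h1] := leqP l1 r; last by rewrite bin_small.
have [h2|h2] := leqP l2 (r - l1); last by rewrite (bin_small h2) !muln0.
have [h3|h3] := leqP l3 (r - l1 - l2); last by rewrite (bin_small h3) muln0.
by rewrite (@bin_small (r - l1 - l2 - l3)) ?muln0 //; lia.
Qed.

Lemma bin4_multinom4 (r l1 l2 l3 l4 : nat) : (l1 + l2 + l3 + l4 <= r)%N ->
  bin4 r l1 l2 l3 l4 = ('C(r, l1 + l2 + l3 + l4) * multinom4 l1 l2 l3 l4)%N.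
Proof.
move=> hr; set h := (l1 + l2 + l3 + l4)%N in hr *.
set D := (l1`! * l2`! * l3`! * l4`!)%N.
have D_gt0 : (0 < D)%N by rewrite !muln_gt0 !fact_gt0.
(* The case r = h of [bin4_fact] shows that the truncated division in [multinom4] is exact. *)
have hh : (multinom4 l1 l2 l3 l4 * D = h`!)%N.
  have := @bin4_fact h l1 l2 l3 l4 (leqnn _); rewrite subnn muln1 => <-.
  have := @bin4_fact h l1 l2 l3 l4 (leqnn _); rewrite subnn muln1 => hD.
  by rewrite /multinom4 -/h -/D -hD mulnK.
apply/eqP; rewrite -(eqn_pmul2r D_gt0) -(eqn_pmul2r (fact_gt0 (r - h))) bin4_fact //.
by rewrite -[('C(r, h) * _ * D)%N]mulnA hh -mulnA bin_fact.
Qed.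

(** A bound independent of the exponent gives all nested sums the same range; the extra binomial
    coefficients are zero. *)
Lemma exprDn_wide (R : comNzRingType) (x y : R) (n N : nat) : (n <= N)%N ->
  (x + y) ^+ n = \sum_(i < N.+1) 'C(n, i)%:R * x ^+ i * y ^+ (n - i).
Proof.
move=> le_nN; rewrite addrC exprDn.
rewrite -(big_mkord xpredT (fun i => y ^+ (n - i) * x ^+ i *+ 'C(n, i))).
rewrite -(big_mkord xpredT (fun i => 'C(n, i)%:R * x ^+ i * y ^+ (n - i))).
rewrite [RHS](big_cat_nat _ (_ : n.+1 <= N.+1)%N) //= [X in _ + X]big_nat_cond.
rewrite [X in _ + X]big1 ?addr0.
  by apply: eq_bigr => i _; rewrite -mulr_natl; ring.
by move=> i /andP[/andP[lt_ni _] _]; rewrite bin_small // !mul0r.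
Qed.

Lemma expr_sum4 (R : comNzRingType) (y1 y2 y3 y4 : R) (r : nat) :
  (y1 + (y2 + (y3 + (y4 + 1)))) ^+ r =
  \sum_(l1 < r.+1) \sum_(l2 < r.+1) \sum_(l3 < r.+1) \sum_(l4 < r.+1)
    (bin4 r l1 l2 l3 l4)%:R * (y1 ^+ l1 * y2 ^+ l2 * y3 ^+ l3 * y4 ^+ l4).
Proof.
rewrite (exprDn_wide _ _ (leqnn r)); apply: eq_bigr => l1 _.
rewrite (exprDn_wide _ _ (leq_subr l1 r)) mulr_sumr; apply: eq_bigr => l2 _.
rewrite (@exprDn_wide _ _ _ (r - l1 - l2) r) -?subnDA ?leq_subr // !mulr_sumr.
apply: eq_bigr => l3 _.
rewrite (@exprDn_wide _ _ _ (r - (l1 + l2) - l3) r) -?subnDA ?leq_subr // !mulr_sumr.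
apply: eq_bigr => l4 _; rewrite /bin4 expr1n -!subnDA !natrM.
by ring.
Qed.

Lemma genfun_power (K : finType) (W : K -> nat) (r : nat) :
  \sum_(f : {ffun 'I_r -> K}) 'X^(\sum_j W (f j)) =
  (\sum_x 'X^(W x)) ^+ r :> {poly int}.
Proof.
rewrite -[in RHS](card_ord r) -prodr_const bigA_distr_bigA /=.
by apply: eq_bigr => f _; rewrite (big_morph (fun n => 'X^n) (exprD _) (expr0 _)).
Qed.

Lemma coef_genfun (I : finType) (W : I -> nat) (N : nat) :
  (\sum_i 'X^(W i) : {poly int})`_N = #|[set i | W i == N]|%:R.
Proof.
rewrite coef_sum -sum1_card natr_sum [RHS]big_mkcond.
by apply: eq_bigr => i _; rewrite coefXn inE eq_sym; case: ifP.
Qed.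

(* The proof [charF] is an argument so that instances can be inferred. *)
Definition frob_fixed (F : finFieldType) (p m : nat) (charF : p \in [pchar F]) : {pred F} :=
  fun x => x ^+ (p ^ m) == x.

(** * The subfield of order q and the relative trace *)

Section FrobeniusFixed.

Variables (F : finFieldType) (p m : nat) (charF : p \in [pchar F]).

Fact frob_fixed_divring_closed : divring_closed (frob_fixed m charF).
Proof.
split=> [|x y|x y]; rewrite !unfold_in.
- by rewrite expr1n.
- move=> /eqP hx /eqP hy; rewrite (pchar_exprD charF) exprNn hx hy.
  have := pchar_exprD charF m 1 (-1); rewrite subrr expr1n expr0n expn_eq0 -leqn0 leqNgt.
  rewrite prime_gt0 /=; last by case/andP: charF.
  by move/esym/eqP; rewrite addrC addr_eq0 => /eqP ->; rewrite mulN1r.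
- by move=> /eqP hx /eqP hy; rewrite exprMn exprVn hx hy.
Qed.

HB.instance Definition _ :=
  GRing.isDivringClosed.Build F (frob_fixed m charF) frob_fixed_divring_closed.

(** The subfield is made a finite field in its own right, so that the results on the code of index 4
    apply to it. *)
Record frob_subfield := FrobSubfield {
  frob_subfield_val : F;
  _ : frob_subfield_val \in frob_fixed m charF }.

HB.instance Definition _ := [isSub for frob_subfield_val].
HB.instance Definition _ := [Finite of frob_subfield by <:].
HB.instance Definition _ := [SubChoice_isSubIntegralDomain of frob_subfield by <:].
HB.instance Definition _ := [SubIntegralDomain_isSubField of frob_subfield by <:].

(** The fixed points are 0 and the (q - 1)-th roots of unity, all of which are powers of [g]. *)
Lemma card_frob_subfield (g : F) :
  ((p ^ m).-1).-primitive_root g -> #|{: frob_subfield}| = (p ^ m)%N.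
Proof.
move=> g_prim; rewrite card_sub -sum1_card (bigD1 0) /=; last first.
  by rewrite inE unfold_in /= expr0n expn_eq0 -leqn0 leqNgt prime_gt0 //; case/andP: charF.
have q_gt0 : (0 < p ^ m)%N.
  by rewrite expn_gt0 prime_gt0 //; case/andP: charF.
rewrite (eq_bigl (fun y : F => y ^+ (p ^ m).-1 == 1)) => [|y].
  by rewrite (big_unity_roots _ _ g_prim) sum1_card card_ord add1n prednK.
rewrite inE unfold_in /=; have [->|y0] := eqVneq y 0.
  by rewrite andbF expr0n eqn0Ngt (prim_order_gt0 g_prim) eq_sym oner_eq0.
by rewrite andbT -{1}(prednK q_gt0) exprS -{3}[y]mulr1 (inj_eq (mulfI y0)).
Qed.

Lemma val_trace_abs (n : nat) (x : frob_subfield) :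
  val (trace_abs p n x) = trace_abs p n (val x).
Proof. by rewrite rmorph_sum; apply: eq_bigr => i _; rewrite rmorphXn. Qed.

End FrobeniusFixed.

Section RelativeTrace.

Variables (F : finFieldType) (p m r : nat) (charF : p \in [pchar F]).
Hypotheses (r_gt0 : (0 < r)%N) (cardF : #|F| = ((p ^ m) ^ r)%N).

Definition relative_trace (x : F) : F := \sum_(i < r) x ^+ ((p ^ m) ^ i).

Lemma relative_trace_fixed (x : F) : relative_trace x \in frob_fixed m charF.
Proof.
rewrite unfold_in /= /relative_trace (pchar_expr_sum charF).
under eq_bigr do rewrite -exprM -expnSr.
case: r r_gt0 cardF => // r' _ hF; rewrite big_ord_recr big_ord_recl /=.
by rewrite -hF expf_card expr1 addrC.
Qed.

Lemma relative_traceZ (u x : F) :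
  u \in frob_fixed m charF -> relative_trace (x * u) = relative_trace x * u.
Proof.
rewrite unfold_in /= => /eqP hu; rewrite /relative_trace mulr_suml.
apply: eq_bigr => i _; rewrite exprMn; congr (_ * _).
by elim: (i : nat) => [|j IHj]; rewrite ?expr1 // expnS exprM hu.
Qed.

Lemma trace_abs_relative (x : F) :
  trace_abs p (m * r) x = trace_abs p m (relative_trace x).
Proof.
rewrite /trace_abs mulnC (big_ord_mul _ _ _ (fun i => x ^+ (p ^ i))) exchange_big /=.
apply: eq_bigr => j _; rewrite (pchar_expr_sum charF); apply: eq_bigr => i _.
by rewrite -exprM -expnM -expnD [(i * m)%N]mulnC.
Qed.

(* Since beta^q = zeta * beta, the relative traces of the gamma * beta^j are,
   up to the factors beta^j, the discrete Fourier transform of the conjugates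
   of gamma. *)
Lemma relative_trace_inversion (beta gamma : F) :
  beta != 0 -> r.-primitive_root (beta ^+ (p ^ m).-1) -> p ^ m = 1 %[mod r] ->
  \sum_(j < r) beta ^- j * relative_trace (gamma * beta ^+ j) = r%:R * gamma.
Proof.
set zeta := beta ^+ (p ^ m).-1 => b0 zeta_prim hqr.
have q_gt0 : (0 < p ^ m)%N by rewrite expn_gt0 prime_gt0 //; case/andP: charF.
(* By induction: zeta is fixed by the power q, because q is 1 modulo its order [r]. *)
have betaq i : beta ^+ ((p ^ m) ^ i) = beta * zeta ^+ i.
  elim: i => [|i IHi]; first by rewrite mulr1.
  rewrite expnSr exprM IHi exprMn -{1}(prednK q_gt0) exprS -/zeta.
  rewrite -mulrA exprS; congr (_ * (_ * _)).
  rewrite -exprM -(prim_expr_mod zeta_prim) -modnMmr hqr modnMmr muln1.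
  exact: prim_expr_mod.
transitivity (\sum_(i < r) gamma ^+ ((p ^ m) ^ i) * \sum_(j < r) (zeta ^+ i) ^+ j).
  under [RHS]eq_bigr do rewrite mulr_sumr.
  rewrite exchange_big /=; apply: eq_bigr => j _; rewrite mulr_sumr.
  apply: eq_bigr => i _; rewrite exprMn mulrCA; congr (_ * _).
  have -> : (beta ^+ j) ^+ ((p ^ m) ^ i) = beta ^+ j * (zeta ^+ i) ^+ j.
    by rewrite exprAC betaq exprMn.
  by rewrite mulKf // expf_neq0.
rewrite (bigD1 (Ordinal r_gt0)) //= [X in _ + X]big1 ?addr0.
  under eq_bigr do rewrite expr1n.
  by rewrite sumr_const card_ord expr1 mulrC.
move=> i; rewrite -val_eqE /= => i0.
rewrite geometric_unity_root ?mulr0 //.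
  by rewrite exprAC (prim_expr_order zeta_prim) expr1n.
by rewrite -(prim_order_dvd zeta_prim) /dvdn modn_small.
Qed.

End RelativeTrace.

(** The element 0 contributes 1, and the weight is constant on each of the four cosets of fourth
    powers, which have [c] elements each. *)
Lemma coset_weight_genfun (K : finFieldType) (p m c : nat) (g : K) :
  (0 < p)%N -> #|K| = (4 * c).+1 -> (4 * c).-primitive_root g ->
  \sum_(x : K) 'X^(coset_weight p m c x) =
  1 + c%:R * \sum_(k < 4) 'X^(coset_weight p m c (g ^+ k)) :> {poly int}.
Proof.
move=> p_gt0 cardK g_prim; rewrite (bigD1 0) //= coset_weight0 // expr0; congr (_ + _).
rewrite (big_neq0 cardK g_prim) /= mulnC.
rewrite (big_ord_mul _ _ _ (fun e => 'X^(coset_weight p m c (g ^+ e)))) exchange_big /=.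
rewrite mulr_sumr; apply: eq_bigr => k _.
rewrite (eq_bigr (fun _ => 'X^(coset_weight p m c (g ^+ k)))) => [|s _].
  by rewrite sumr_const card_ord mulr_natl.
congr 'X^_; rewrite exprD mulrC coset_weightM ?(prim_expr_neq0 g_prim) //.
by rewrite -exprM -mulnA mulnC exprM (prim_expr_order g_prim) expr1n.
Qed.

Section CodeReduction.

Variables (F : finFieldType) (p m r c : nat) (charF : p \in [pchar F]).
Hypotheses (r_gt0 : (0 < r)%N) (cardF : #|F| = ((p ^ m) ^ r)%N).
Hypotheses (q_c : (p ^ m = 4 * c + 1)%N) (q_r : p ^ m = 1 %[mod r]).
Variables g beta : F.
Hypotheses (g_prim : (4 * c).-primitive_root g) (beta_g : beta ^+ r = g ^+ 4).
Hypotheses (zeta_prim : r.-primitive_root (beta ^+ (p ^ m).-1)) (rF : r%:R != 0 :> F).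

Local Notation K := (frob_subfield m charF).

Let cardK : #|{: K}| = (4 * c).+1.
Proof. by rewrite (@card_frob_subfield F p m charF g) q_c addn1. Qed.

Fact subfield_generator_fixed : g \in frob_fixed m charF.
Proof. by rewrite unfold_in /= q_c exprD (prim_expr_order g_prim) mul1r expr1. Qed.

Definition subfield_generator : K := FrobSubfield subfield_generator_fixed.

Lemma subfield_generator_prim : (4 * c).-primitive_root subfield_generator.
Proof. by rewrite -(fmorph_primitive_root (val : K -> F)). Qed.

Let beta_neq0 : beta != 0.
Proof.
apply: contraTneq (g_prim) => b0; move: beta_g; rewrite b0 expr0n eqn0Ngt r_gt0 => /esym/eqP.
by rewrite expf_eq0 -[g]expr1 (negPf (prim_expr_neq0 g_prim 1)).
Qed.

Definition code_coords (gamma : F) : {ffun 'I_r -> K} :=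
  [ffun j : 'I_r => FrobSubfield (relative_trace_fixed charF r_gt0 cardF (gamma * beta ^+ j))].

(** The inversion formula gives injectivity, as [r] is invertible in [F]; both sides have q^r
    elements. *)
Lemma code_coords_bij : bijective code_coords.
Proof.
apply: inj_card_bij => [x y hxy|].
  apply: (mulfI rF); rewrite -!(relative_trace_inversion charF r_gt0 _ beta_neq0 zeta_prim q_r).
  apply: eq_bigr => j _; congr (_ * _).
  by move/ffunP/(_ j)/(congr1 val): hxy; rewrite !ffunE.
by rewrite card_ffun card_ord cardK cardF q_c addn1.
Qed.

(** Positions are written as sr + j. Then beta^(sr+j) = g^(4s) beta^j, and the factor g^(4s), lying
    in the subfield, comes out of the relative trace. For fixed j it runs through the fourth
    powers. *)
Lemma cw_weight_coords (omega gamma : F) (k : nat) : omega ^+ k = beta ->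
  cw_weight p (m * r) k (c * r) omega gamma =
  (\sum_j coset_weight p m c (code_coords gamma j))%N.
Proof.
move=> hbeta; rewrite /cw_weight -sum1_card big_mkcond /=.
under eq_bigr do rewrite inE exprM hbeta.
rewrite (big_ord_mul _ _ _ (fun i =>
  if trace_abs p (m * r) (gamma * beta ^+ i) != 0 then 1%N else 0%N)) exchange_big /=.
apply: eq_bigr => j _; rewrite /coset_weight -sum1_card.
under [RHS]eq_bigl do rewrite inE.
rewrite [RHS]big_mkcondr /=.
have c_gt0 : (0 < c)%N by have := prim_order_gt0 g_prim; rewrite muln_gt0.
have g4_prim : c.-primitive_root (subfield_generator ^+ 4).
  by have := dvdn_prim_root subfield_generator_prim (dvdn_mull 4 (dvdnn c)); rewrite mulnK.
rewrite (big_unity_roots _ _ g4_prim); apply: eq_bigr => s _.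
rewrite ffunE; set x := FrobSubfield _.
have -> : trace_abs p (m * r) (gamma * beta ^+ (s * r + j)) =
    val (trace_abs p m (x * (subfield_generator ^+ 4) ^+ s)).
  rewrite val_trace_abs (trace_abs_relative m r charF); congr trace_abs.
  rewrite rmorphM !rmorphXn /= -(relative_traceZ r (charF := charF)); last first.
    by rewrite !rpredX // subfield_generator_fixed.
  by rewrite -beta_g -exprM -mulrA -exprD mulnC addnC.
by rewrite fmorph_eq0.
Qed.

Lemma code_genfun (omega : F) (k : nat) : omega ^+ k = beta ->
  \sum_gamma 'X^(cw_weight p (m * r) k (c * r) omega gamma) =
  (1 + c%:R * \sum_(k < 4) 'X^(coset_weight p m c (subfield_generator ^+ k))) ^+ r
    :> {poly int}.
Proof.
move=> hbeta; have p_gt0 : (0 < p)%N by rewrite prime_gt0 //; case/andP: charF.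
rewrite -(coset_weight_genfun _ p_gt0 cardK subfield_generator_prim) -genfun_power.
rewrite [RHS](reindex code_coords) /=; last exact: onW_bij code_coords_bij.
by apply: eq_bigr => gamma _; rewrite cw_weight_coords.
Qed.

End CodeReduction.

(** * Reading the frequencies off the weight enumerator *)

Lemma wgt_linear (p t : nat) (a b : int) (l1 l2 l3 l4 : nat) :
  wgt p t a b l1 l2 l3 l4 =
  l1%:R * wgt p t a b 1 0 0 0 + l2%:R * wgt p t a b 0 1 0 0 +
  l3%:R * wgt p t a b 0 0 1 0 + l4%:R * wgt p t a b 0 0 0 1.
Proof.
rewrite /wgt /= !mul1n -!pmulrn !natrM !natrD !(rmorphB, rmorphM, rmorphD) /= -!pmulrn.
by ring.
Qed.

(** In the multinomial expansion [l_i] counts the coordinates of weight [v_i], each bringing a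
    factor [c]; the summand 1 accounts for the r - h zero coordinates. *)
Lemma genfun_bin4 (c r v1 v2 v3 v4 N : nat) :
  ((1 + c%:R * ('X^v1 + 'X^v2 + 'X^v3 + 'X^v4)) ^+ r : {poly int})`_N =
  (\sum_(l1 < r.+1) \sum_(l2 < r.+1) \sum_(l3 < r.+1)
    \sum_(l4 < r.+1 | (l1 + l2 + l3 + l4 <= r)%N &&
                      (l1 * v1 + l2 * v2 + l3 * v3 + l4 * v4 == N)%N)
      freqA r c l1 l2 l3 l4)%:R.
Proof.
have -> : 1 + c%:R * ('X^v1 + 'X^v2 + 'X^v3 + 'X^v4) =
    c%:R * 'X^v1 + (c%:R * 'X^v2 + (c%:R * 'X^v3 + (c%:R * 'X^v4 + 1))) :> {poly int}.
  by rewrite !mulrDr addrC -!addrA.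
rewrite expr_sum4 coef_sum natr_sum; apply: eq_bigr => l1 _.
rewrite coef_sum natr_sum; apply: eq_bigr => l2 _.
rewrite coef_sum natr_sum; apply: eq_bigr => l3 _.
rewrite coef_sum natr_sum [RHS]big_mkcond; apply: eq_bigr => l4 _.
have -> : (bin4 r l1 l2 l3 l4)%:R * ((c%:R * 'X^v1) ^+ l1 * (c%:R * 'X^v2) ^+ l2 *
      (c%:R * 'X^v3) ^+ l3 * (c%:R * 'X^v4) ^+ l4) =
    (bin4 r l1 l2 l3 l4 * c ^ (l1 + l2 + l3 + l4))%:R *
    'X^(l1 * v1 + l2 * v2 + l3 * v3 + l4 * v4) :> {poly int}.
  rewrite !exprMn -!exprM [(l1 * _)%N]mulnC [(l2 * _)%N]mulnC [(l3 * _)%N]mulnC.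
  by rewrite [(l4 * _)%N]mulnC natrM natrX !exprD; ring.
rewrite mulr_natl coefMn coefXn eq_sym /freqA.
have [hr|hr] := boolP (l1 + l2 + l3 + l4 <= r)%N; last by rewrite bin4_eq0 // mul0n.
by rewrite bin4_multinom4 //=; case: (_ == N); rewrite ?mul0rn.
Qed.

Theorem theorem5p3
  (p r t : nat) (a b : int) (F : finFieldType) (omega : F)
  (hp : prime p) (hr : prime r) (hpr : p != r)
  (hp4 : p = 1 %[mod 4]) (hr4 : coprime 4 r) (ht : (1 <= t)%N)
  (hqr : (p ^ (4 * t))%N = 1 %[mod r])
  (hab : a ^+ 2 + 4 * b ^+ 2 = ((p ^ (2 * t))%N)%:Z)
  (ha4 : (a = 1 %[mod 4])%Z)
  (hap : coprime `|a|%N p)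
  (hchar : p \in [pchar F])
  (hcard : #|F| = ((p ^ (4 * t)) ^ r)%N)
  (homega : (((p ^ (4 * t)) ^ r).-1).-primitive_root omega) :
  let m := (4 * t)%N in
  let q := (p ^ m)%N in
  let Q := (q ^ r)%N in
  let c := ((q - 1) %/ 4)%N in
  let k := ((4 * Psi r q) %/ r)%N in
  let n := ((Q - 1) %/ k)%N in
  forall w : rat,
    #|[set gamma : F | (cw_weight p (m * r) k n omega gamma)%:R == w]| =
    (\sum_(l1 < r.+1) \sum_(l2 < r.+1) \sum_(l3 < r.+1)
       \sum_(l4 < r.+1 | ((l1 + l2 + l3 + l4 <= r)%N
                          && (wgt p t a b l1 l2 l3 l4 == w)))
         freqA r c l1 l2 l3 l4)%N.
Proof.
move=> m q Q c k n w.
have r_gt0 := prime_gt0 hr.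
have q_mod4 : q = 1 %[mod 4] by rewrite /q -modnXm hp4 modnXm exp1n.
have q_c : q = (4 * c + 1)%N by rewrite /c; move: q_mod4; clear; lia.
have q_pred : q.-1 = (4 * c)%N by rewrite q_c addn1.
have q_gt1 : (1 < q)%N.
  by rewrite -(exp1n m) ltn_exp2r ?prime_gt1 // muln_gt0.
have c_gt0 : (0 < c)%N by move: q_gt1 q_c; clear; lia.
have hQ : Q.-1 = (4 * c * Psi r q)%N by rewrite predn_exp q_pred.
have kr : (k * r = 4 * Psi r q)%N.
  (* Each of the [r] terms of Psi is 1 modulo [r], so [r] divides Psi and the division defining [k]
     is exact. *)
  rewrite divnK // dvdn_mull // /Psi /dvdn -modn_summ.
  under eq_bigr do rewrite -modnXm hqr modnXm exp1n.
  by rewrite modn_summ sum_nat_const card_ord muln1 modnn.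
have hQk : Q.-1 = (k * (c * r))%N.
  by rewrite hQ mulnCA kr; ring.
have Q1_gt0 := prim_order_gt0 homega; rewrite -/m -/q -/Q in Q1_gt0.
have k_gt0 : (0 < k)%N by move: Q1_gt0; rewrite hQk muln_gt0 => /andP[].
have n_c : n = (c * r)%N by rewrite /n subn1 hQk mulKn.
have g_prim : (4 * c).-primitive_root (omega ^+ Psi r q).
  have := dvdn_prim_root homega (_ : 4 * c %| Q.-1)%N.
  by rewrite hQ dvdn_mulr // mulKn ?muln_gt0 // => /(_ isT).
have beta_g : (omega ^+ k) ^+ r = (omega ^+ Psi r q) ^+ 4.
  by rewrite -!exprM kr mulnC.
(* The element omega^(kc) has order [r], and its fourth power keeps this order since 4 is prime to
   [r]. *)
have zeta_prim : r.-primitive_root ((omega ^+ k) ^+ q.-1).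
  have := dvdn_prim_root homega (_ : r %| Q.-1)%N.
  rewrite hQk mulnA dvdn_mull // mulnK // => /(_ isT) h.
  rewrite q_pred -exprM mulnCA mulnC exprM.
  by rewrite (prim_root_exp_coprime 4 h).
have rF : r%:R != 0 :> F by rewrite -(dvdn_pcharf hchar) dvdn_prime2.
have := code_genfun hchar r_gt0 hcard q_c hqr g_prim beta_g zeta_prim rF erefl.
set gK := subfield_generator _ _ _ => hgen.
have gK_prim : (4 * c).-primitive_root gK by exact: subfield_generator_prim.
have cardK : #|{: frob_subfield m hchar}| = q.
  by apply: (card_frob_subfield _ (g := omega ^+ Psi r q)); rewrite q_pred.
have charK : p \in [pchar (frob_subfield m hchar)] := card_finPcharP cardK hp.
have [z z_prim] := C_prim_root_exists (prime_gt0 hp).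
have pa : ~~ (p %| a)%Z.
  by rewrite dvdzE -prime_coprime // coprime_sym.
have oa : ~~ (2 %| a)%Z by move: ha4; clear; lia.
have hab' : a ^+ 2 + 4 * b ^+ 2 = p%:Z ^+ (2 * t).
  by rewrite hab -[p%:Z]natz -natrX natz.
have hperm := quartic_weights_perm charK hp4 ht cardK q_c gK_prim z_prim hab' pa oa.
set L := (X in perm_eq _ X) in hperm.
(* The entries of [L] are rational by type but permute actual weights, so truncation loses
   nothing. *)
pose v i := Num.truncn (nth 0 L i).
have vE i : (i < 4)%N -> (v i)%:R = nth 0 L i.
  move=> lt_i4; apply/eqP; rewrite truncnK //.
  have : nth 0 L i \in L by rewrite mem_nth.
  by rewrite -(perm_mem hperm) => /mapP[? _ ->]; rewrite natr_nat.
have hsum4 : \sum_(k < 4) 'X^(coset_weight p m c (gK ^+ k)) =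
    'X^(v 0%N) + 'X^(v 1%N) + 'X^(v 2) + 'X^(v 3) :> {poly int}.
  rewrite -(big_mkord xpredT (fun k => 'X^(coset_weight p m c (gK ^+ k)))).
  transitivity (\sum_(x <- [seq (coset_weight p m c (gK ^+ k))%:R : rat | k <- iota 0 4])
      'X^(Num.truncn x) : {poly int}).
    by rewrite big_map; apply: eq_bigr => i _; rewrite natrK.
  by rewrite (perm_big _ hperm) /L !big_cons big_nil /= addr0 !addrA.
rewrite hsum4 in hgen.
have wE l1 l2 l3 l4 : wgt p t a b l1 l2 l3 l4 =
    (l1 * v 0 + l2 * v 1 + l3 * v 2 + l4 * v 3)%N%:R.
  by rewrite wgt_linear !natrD !natrM !vE.
(* For [w] not a natural number both sides are 0. *)
have [/natrP[N ->]|wN] := boolP (w \is a Num.nat); last first.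
  have neq_w i : (i%:R == w) = false by apply: contraNF wN => /eqP <-; rewrite natr_nat.
  rewrite eq_card0 => [|gamma]; last by rewrite inE neq_w.
  apply/esym; do 3!(apply: big1 => ? _).
  by apply: big1 => ?; rewrite wE neq_w andbF.
apply/eqP; rewrite -(eqr_nat int); apply/eqP.
have := congr1 (fun P : {poly int} => P`_N) hgen; rewrite coef_genfun n_c.
rewrite genfun_bin4 => hN.
transitivity (#|[set i | cw_weight p (m * r) k (c * r) omega i == N]|%:R : int).
  by congr (_%:R); apply: eq_card => gamma; rewrite !inE eqr_nat.
rewrite hN; congr (_%:R); do 3!(apply: eq_bigr => ? _); apply: eq_bigl => ?.
by rewrite wE eqr_nat.
Qed.
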